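(* Let $d>0$, let $K\subset\mathbb{C}$ be a compact $d$-set, and let $f$ be a subharmonic function defined in an open neighbourhood of $K$. Then there is a constant $C=C(K,f,d)$ such that for every $x\in K$, every $t>0$ and every $1\le p\le\infty$, with $K_{x,t}:=\mathbb{D}(x,t)\cap K$, $$\left(\frac{1}{\mathcal{H}^d(K_{x,t})}\int_{K_{x,t}}e^{pf}\,d\mathcal{H}^d\right)^{1/p}\le C\,\frac{1}{\mathcal{H}^d(K_{x,t})}\int_{K_{x,t}}e^{f}\,d\mathcal{H}^d .$$
   Context: $\mathbb{D}(x,t)=\{z\in\mathbb{C}:|z-x|<t\}$; $\mathcal{H}^d$ is the $d$-dimensional Hausdorff measure. A compact set $K\subset\mathbb{C}$ is a $d$-set if there are constants $a,b>0$ with $b t^d\le\mathcal{H}^d(K\cap\mathbb{D}(x,t))\le a t^d$ for all $x\in K$ and $0<t\le\operatorname{diam}(K)$. For $p=\infty$ the left-hand side is understood as the supremum of $e^f$ over $K_{x,t}$. Subharmonic functions take values in $[-\infty,\infty)$ (with $e^{-\infty}=0$) and, by the usual convention, are not identically $-\infty$ on any connected component of their domain. *)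

(* Defs.v *)
From HB Require Import structures.
From mathcomp Require Import all_boot all_order all_algebra.
From mathcomp Require Import complex.
From mathcomp Require Import all_classical all_reals all_analysis.

Set Implicit Arguments.
Unset Strict Implicit.
Unset Printing Implicit Defensive.
Import Order.TTheory GRing.Theory Num.Theory.
Import numFieldNormedType.Exports.
Local Open Scope classical_set_scope.
Local Open Scope complex_scope.
Local Open Scope ring_scope.

(* The library puts no topology on R[i]; this is the metric topology of the
   modulus.  The modulus `|z| is valued in R[i]: its real-valued version, used
   below for all distances, is normc z, with `|z| = (normc z)%:C. *)
HB.instance Definition _ (R : realType) :=
  PseudoMetricNormedZmod.copy R[i] (R[i])^o.

Notation normc := ComplexField.Normc.normc.

Section complex_plane.
Context {R : realType}.
Implicit Types (A K U : set R[i]) (z w x : R[i]).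

Definition disc x (t : R) : set R[i] := [set z | normc (z - x) < t].

Definition closed_disc x (t : R) : set R[i] := [set z | normc (z - x) <= t].

(* diam set0 = -oo *)
Definition diam A : \bar R :=
  ereal_sup [set (normc (z.1 - z.2))%:E | z in A `*` A].

End complex_plane.

Section hausdorff_measure.
Context {R : realType}.
Variable d : R.
Implicit Types (A : set R[i]) (delta : R).
Local Open Scope ereal_scope.

(* (diam A)^d, with the usual convention that the empty set contributes 0
   whatever d is. *)
Definition diam_pow A : \bar R := if A == set0 then 0 else diam A `^ d.

Definition hausdorff_content delta A : \bar R :=
  ereal_inf [set \sum_(k <oo) diam_pow (F k) | F in
    [set F : (set R[i])^nat |
      (forall k, diam (F k) <= delta%:E) /\ A `<=` \bigcup_k F k]].

(* No normalizing constant: H^d is the supremum (= limit as delta -> 0) of the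
   contents above. *)
Definition hausdorff A : \bar R :=
  ereal_sup [set hausdorff_content delta A | delta in [set e : R | (0 < e)%R]].

Lemma diam_pow0 : diam_pow set0 = 0.
Proof. by rewrite /diam_pow eqxx. Qed.

Lemma diam_pow_ge0 A : 0 <= diam_pow A.
Proof. by rewrite /diam_pow; case: ifP => // _; exact: poweR_ge0. Qed.

Lemma diam_set0 : diam (@set0 R[i]) = -oo.
Proof. by rewrite /diam setX0 image_set0 ereal_sup0. Qed.

Lemma hausdorff_content_ge0 delta A : 0 <= hausdorff_content delta A.
Proof.
apply: le_ereal_inf_tmp => _ [F _ <-]; apply: nneseries_ge0 => k _ _.
exact: diam_pow_ge0.
Qed.

Lemma hausdorff_content_le_sup delta A : (0 < delta)%R ->
  hausdorff_content delta A <= hausdorff A.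
Proof. by move=> d0; apply: ereal_sup_ubound; exists delta. Qed.

Lemma hausdorff_ge0 A : 0 <= hausdorff A.
Proof.
exact: le_trans (hausdorff_content_ge0 1 A) (hausdorff_content_le_sup _ ltr01).
Qed.

Lemma hausdorff0 : hausdorff set0 = 0.
Proof.
apply/eqP; rewrite eq_le hausdorff_ge0 andbT.
apply: ge_ereal_sup => _ [delta _ <-]; apply: ereal_inf_lbound.
exists (fun=> set0); first by split=> // k; rewrite diam_set0 leNye.
by rewrite eseries0// => k _ _; rewrite diam_pow0.
Qed.

Lemma le_hausdorff : {homo hausdorff : A B / A `<=` B >-> A <= B}.
Proof.
move=> A B AB; apply: ge_ereal_sup => _ [delta d0 <-].
apply: le_trans (hausdorff_content_le_sup B d0).
apply: ereal_inf_le_tmp => _ [F [dF BF] <-]; exists F => //.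
by split=> //; exact: subset_trans BF.
Qed.

Lemma hausdorff_content_sigma_subadditive delta :
  sigma_subadditive (hausdorff_content delta).
Proof.
move=> A; have ge0 := hausdorff_content_ge0 delta.
have [[i ioo]|] := pselect (exists i, hausdorff_content delta (A i) = +oo).
  rewrite (eseries_pinfty _ _ ioo) ?leey// => n _.
  by rewrite -ltNye (lt_le_trans _ (ge0 _)).
rewrite -forallNE => Aoo.
suff add2e (e : {posnum R}) : hausdorff_content delta (\bigcup_n A n) <=
    \sum_(i <oo) hausdorff_content delta (A i) + e%:num%:E.
  by apply/lee_addgt0Pr => _/posnumP[].
rewrite (le_trans _ (epsilon_trick _ _ _))//.
pose P n (B : (set R[i])^nat) :=
  [/\ forall k, diam (B k) <= delta%:E, A n `<=` \bigcup_k B k &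
  \sum_(k <oo) diam_pow (B k) <=
    hausdorff_content delta (A n) + (e%:num / (2 ^ n.+1)%:R)%:E].
have [G PG] : {G : ((set R[i])^nat)^nat & forall n, P n (G n)}.
  apply: (@choice _ _ P) => n; rewrite /P /hausdorff_content.
  set S := (X in ereal_inf X); move infS : (ereal_inf S) => iS.
  case: iS infS => [r Sr|Soo|Soo].
  - have en1 : (0 < e%:num / (2 ^ n.+1)%:R)%R by [].
    have /(lb_ereal_inf_adherent en1) : ereal_inf S \is a fin_num by rewrite Sr.
    move=> [_ [B [dB AnB] <-]]; rewrite Sr => lt_e.
    by exists B; split => //; exact/ltW.
  - by have := Aoo n; rewrite /hausdorff_content Soo.
  - by have := ge0 (A n); rewrite /hausdorff_content Soo.
have muG_ge0 x : 0 <= (diam_pow \o uncurry G) x by exact: diam_pow_ge0.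
apply: (@le_trans _ _ (\esum_(i in setT) (diam_pow \o uncurry G) i)).
  apply: ereal_inf_lbound => /=.
  have /card_esym/ppcard_eqP[f] := card_nat2.
  exists (uncurry G \o f).
    split=> [k|t [i _ Ait]].
      by rewrite /= /uncurry; case: (f k) => i j; have [+ _ _] := PG i; apply.
    have [_ /(_ _ Ait)[j _ Gij] _] := PG i.
    by exists (f^-1%FUN (i, j)) => //=; rewrite invK ?inE.
  rewrite -(esum_pred_image (diam_pow \o uncurry G) _ xpredT)//
    ?[fun=> _]set_true//.
  by rewrite image_eq.
rewrite (_ : esum _ _ = \sum_(i <oo) \sum_(j <oo) diam_pow (G i j)); last first.
  pose J : nat -> set (nat * nat) := fun i => [set (i, j) | j in setT].
  rewrite (_ : setT = \bigcup_k J k); last first.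
    by rewrite predeqE => -[a b]; split => // _; exists a => //; exists b.
  rewrite esum_bigcupT /=; last 2 first.
    - apply/trivIsetP => i j _ _ ij.
      rewrite predeqE => -[n m] /=; split => //= -[] [_] _ [<-{n} _].
      by move=> [m' _] [] /esym/eqP; rewrite (negbTE ij).
    - by move=> *; exact: diam_pow_ge0.
  rewrite -(image_id [set: nat]) -fun_true esum_pred_image//; last first.
    by move=> n _; apply: esum_ge0 => m _; exact: diam_pow_ge0.
  apply: eq_eseriesr => /= j _.
  rewrite -(esum_pred_image (diam_pow \o uncurry G) (pair j) predT)//=;
    last by move=> ? ? _ _; exact: (@can_inj _ _ _ snd).
  - by congr esum; rewrite predeqE => -[a b]; split; move=> [i _ <-]; exists i.
  - by move=> n _; exact: diam_pow_ge0.
apply: lee_nneseries => [i _ _|i _]; last by have [] := PG i.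
by apply: nneseries_ge0 => j _ _; exact: diam_pow_ge0.
Qed.

Lemma hausdorff_sigma_subadditive : sigma_subadditive hausdorff.
Proof.
move=> A; apply: ge_ereal_sup => _ [delta d0 <-].
apply: le_trans (hausdorff_content_sigma_subadditive delta A) _.
apply: lee_nneseries => [k _ _|k _]; first exact: hausdorff_content_ge0.
exact: hausdorff_content_le_sup.
Qed.

HB.instance Definition _ := isOuterMeasure.Build R R[i] hausdorff
  hausdorff0 hausdorff_ge0 le_hausdorff hausdorff_sigma_subadditive.

(* The d-dimensional Hausdorff measure, on the sigma-algebra of its
   Caratheodory-measurable sets (which contains the Borel sets). *)
Definition hausdorff_outer : {outer_measure set R[i] -> \bar R} := hausdorff.

Definition hausdorff_measure :
    {measure set (caratheodory_type hausdorff_outer) -> \bar R} :=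
  hausdorff_outer : set (caratheodory_type hausdorff_outer) -> \bar R.

End hausdorff_measure.

Definition d_set {R : realType} (d : R) (K : set R[i]) : Prop :=
  exists a b : R, [/\ 0 < a, 0 < b &
    forall x (t : R), K x -> 0 < t -> (t%:E <= diam K)%E ->
      ((b * t `^ d)%:E <= hausdorff_measure d (K `&` disc x t))%E /\
      (hausdorff_measure d (K `&` disc x t) <= (a * t `^ d)%:E)%E].

(* The point z + r * e^(i theta). *)
Definition circle_point {R : realType} (z : R[i]) (r theta : R) : R[i] :=
  z + (r * cos theta +i* (r * sin theta)).

Definition usc_on {R : realType} (U : set R[i]) (f : R[i] -> \bar R) : Prop :=
  forall z, U z -> forall a : R, (f z < a%:E)%E ->
    \forall w \near z, U w -> (f w < a%:E)%E.

(* The circle means are meaningful in the extended reals: f is bounded above on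
   the circle, so only the negative part can have an infinite integral. *)
Record subharmonic {R : realType} (U : set R[i]) (f : R[i] -> \bar R) : Prop :=
  Subharmonic {
    subharmonic_lty : forall z, U z -> (f z < +oo)%E ;
    subharmonic_usc : usc_on U f ;
    subharmonic_submean : forall z (r : R), 0 < r -> closed_disc z r `<=` U ->
      (f z <= ((2 * pi)^-1)%:E *
        \int[lebesgue_measure]_(theta in `[0%R, (2 * pi)%R])
          f (circle_point z r theta))%E ;
    subharmonic_nontrivial : forall z, U z ->
      exists2 w, connected_component U z w & f w <> -oo%E
  }.

Section averages.
Context {R : realType}.
Variable d : R.
Local Open Scope ereal_scope.

Definition haverage (A : set R[i]) (g : R[i] -> \bar R) : \bar R :=
  (hausdorff_measure d A)^-1 * \int[hausdorff_measure d]_(z in A) g z.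

(* The p-th power mean of e^f over A, and the supremum of e^f for p = +oo. *)
Definition exp_mean (p : \bar R) (A : set R[i]) (f : R[i] -> \bar R) : \bar R :=
  match p with
  | r%:E => haverage A (fun z => expeR (r%:E * f z)) `^ r^-1
  | +oo => ereal_sup [set expeR (f z) | z in A]
  | -oo => 0 (* not used: p >= 1 *)
  end.

End averages.

(* Main.v *)
(* Power means are at most suprema, so it suffices to bound sup e^f over
   K_{x,t} by its average, and for this that f >= s - N on a fixed
   proportion of K_{x,t}, where s is the supremum of f over the closed
   disc of radius t. Comparing f with logarithms on annuli (Hadamard's
   three circles) gives f <= s + c on the disc of radius 4t, with c
   independent of x and of small t. If f < s - N on a large part of
   K_{x,t}, spread unit point masses on a maximal rho-separated subset S
   of it: by the d-set property the potential
   sum_(w in S) ln (3t / |z - w|) is at most Q = O((t / rho)^d) off the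
   rho-discs around S, it is nonpositive on the circle of radius 4t and at
   least |S| ln (3/2) on the disc of radius t. The maximum principle then
   yields f <= s + c - ((N + c) / Q) |S| ln (3/2) there, which for N large
   contradicts the choice of s, since |S| is comparable to Q. No Riesz
   decomposition is needed, and the maximum principle only uses that
   ln |z - w| has circle means at most its value at the centre up to a cubic
   error in the radius. *)

Require Import Defs.
From HB Require Import structures.
From mathcomp Require Import all_boot all_order all_algebra.
From mathcomp Require Import complex ring lra.
From mathcomp Require Import all_classical all_reals all_analysis.

Set Implicit Arguments.
Unset Strict Implicit.
Unset Printing Implicit Defensive.
Import Order.TTheory GRing.Theory Num.Theory.
Import numFieldNormedType.Exports.
Local Open Scope classical_set_scope.
Local Open Scope complex_scope.
Local Open Scope ring_scope.

(** * The topology of the plane *)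

Section plane_topology.
Context {R : realType}.
Implicit Types (z w x y : R[i]) (A : set R[i]) (r : R).

Lemma norm_normc z : `|z| = (normc z)%:C.
Proof. by case: z. Qed.

Lemma normc_ge0 z : 0 <= normc z.
Proof. by case: z => a b; exact: sqrtr_ge0. Qed.

Lemma normc_distC z w : normc (z - w) = normc (w - z).
Proof. by apply/complexI; rewrite -!norm_normc distrC. Qed.

Lemma normcB_triangle w z y : normc (z - y) <= normc (z - w) + normc (w - y).
Proof. by rewrite -lecR rmorphD/= -!norm_normc ler_distD. Qed.

Lemma normcBxx z : normc (z - z) = 0.
Proof. by rewrite subrr ComplexField.Normc.normc0. Qed.

Lemma nbhs_disc z A : nbhs z A <-> exists2 r, 0 < r & disc z r `<=` A.
Proof.
split.
  move=> /nbhs_ballP[[e e'] /=]; rewrite ltcE /= => /andP[/eqP-> e0] eA.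
  exists e => // w /= zw; apply: eA; rewrite /ball/= distrC norm_normc.
  by rewrite ltcR.
move=> [r r0 rA]; apply/nbhs_ballP; exists r%:C; first by rewrite /= ltcR.
by move=> w; rewrite /ball/= distrC norm_normc ltcR => /rA.
Qed.

Lemma near_disc z r : 0 < r -> nbhs z (disc z r).
Proof. by move=> r0; apply/nbhs_disc; exists r. Qed.

Lemma normc_gt0 z : z != 0 -> 0 < normc z.
Proof.
move=> z0; rewrite lt_neqAle normc_ge0 andbT eq_sym; apply: contra z0 => /eqP.
by move/ComplexField.Normc.eq0_normc ->.
Qed.

Lemma cvg_normc z x : normc (w - x) @[w --> z] --> normc (z - x).
Proof.
have FFz : ProperFilter (nbhs z) := nbhs_pfilter z.
apply/cvgrPdist_lt => eps eps0; near=> w.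
have zw : normc (w - z) < eps by near: w; exact: near_disc.
have := normcB_triangle w z x; have := normcB_triangle z w x.
by rewrite (normc_distC z w) ltr_norml => ? ?; lra.
Unshelve. all: by end_near. Qed.

Lemma open_disc z r : open (disc z r).
Proof.
rewrite openE => w /= zw; apply/nbhs_disc; exists (r - normc (w - z)).
  by rewrite subr_gt0.
rewrite /disc => y /=; rewrite ltrBrDr => h; exact: le_lt_trans (normcB_triangle w _ _) h.
Qed.

Lemma normc_bounds z : [/\ `|complex.Re z| <= normc z, `|complex.Im z| <= normc z &
  normc z <= `|complex.Re z| + `|complex.Im z|].
Proof.
case: z => a b /=; split.
- by rewrite -sqrtr_sqr ler_wsqrtr// lerDl sqr_ge0.
- by rewrite -sqrtr_sqr ler_wsqrtr// lerDr sqr_ge0.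
- rewrite -[leRHS]ger0_norm ?addr_ge0// -sqrtr_sqr ler_wsqrtr// sqrrD.
  rewrite -(real_normK (num_real a)) -(real_normK (num_real b)).
  by have := mulr_ge0 (normr_ge0 a) (normr_ge0 b); lra.
Qed.

(** The disc lies in the image of a product of two compact segments under the continuous map (a, b)
    -> a + ib, and a closed subset of a compact set is compact. *)
Lemma closed_disc_compact A x r :
  closed A -> A `<=` closed_disc x r -> compact A.
Proof.
move=> cA Ar.
pose Q := `[complex.Re x - r, complex.Re x + r]%classic `*`
  `[complex.Im x - r, complex.Im x + r]%classic.
pose g (p : R * R) : R[i] := p.1 +i* p.2.
have cg : continuous g.
  move=> p; apply/cvgrPdist_lt => -[e e']; rewrite ltcE /= => /andP[/eqP-> e0].
  near=> q; rewrite norm_normc ltcR.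
  have [_ _] := normc_bounds (g p - g q); move/le_lt_trans; apply.
  rewrite /g /= (splitr e) ltrD//.
    near: q; apply: (@cvgr_dist_lt _ _ _ _ (nbhs_filter p) fst p.1 _ (e / 2)).
      exact: cvg_fst.
    by rewrite divr_gt0.
  near: q; apply: (@cvgr_dist_lt _ _ _ _ (nbhs_filter p) snd p.2 _ (e / 2)).
    exact: cvg_snd.
  by rewrite divr_gt0.
have cQ : compact (g @` Q).
  apply: continuous_compact; first exact: continuous_subspaceT.
  by apply: compact_setX; exact: segment_compact.
apply: subclosed_compact cA cQ _ => z /Ar /= zx.
have [h1 h2 _] := normc_bounds (z - x).
exists (complex.Re z, complex.Im z); last by rewrite /g; case: (z).
move: (le_trans h1 zx) (le_trans h2 zx) => {h1 h2 zx}.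
rewrite /Q; move: z x {Ar Q} => [a b] [c d] /=; rewrite !ler_norml => ? ?.
by split; rewrite /= in_itv/=; apply/andP; split; lra.
Unshelve. all: by end_near. Qed.

End plane_topology.

(** If the supremum [s] were not attained, each value would lie below some real level [a < s], and
    by semicontinuity so would the nearby values. Compactness makes one level serve for all of [Z],
    against the choice of [s]. *)
Lemma usc_attains_max (R : realType) (T : topologicalType) (Z : set T)
    (phi : T -> \bar R) : compact Z -> Z !=set0 ->
  (forall z (a : R), Z z -> (phi z < a%:E)%E ->
    \forall w \near z, Z w -> (phi w < a%:E)%E) ->
  exists2 z, Z z & forall w, Z w -> (phi w <= phi z)%E.
Proof.
move=> cZ [z0 Zz0] usc; apply: contrapT => nmax.
pose s := ereal_sup (phi @` Z).
have phis z : Z z -> (phi z < s)%E.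
  move=> Zz; rewrite lt_neqAle; apply/andP; split; last first.
    by apply: ereal_sup_ubound; exists z.
  apply/eqP => pzs; apply: nmax; exists z => // w Zw; rewrite pzs.
  by apply: ereal_sup_ubound; exists w.
have btw z : Z z -> exists2 a : R, (phi z < a%:E)%E & (a%:E < s)%E.
  move=> /phis; move: (phi z) (s) => [p| |] [q| |] //=.
  - rewrite lte_fin => pq; exists ((p + q) / 2); rewrite lte_fin; lra.
  - by move=> _; exists (p + 1); rewrite ?ltry// lte_fin ltrDl.
  - by move=> _; exists (q - 1); rewrite ?ltNyr// lte_fin gtrBl.
  - by move=> _; exists 0; rewrite ?ltNyr ?ltry.
(* The filter of real levels tending to [s] from below; it is the parameter of the near-covering
   form of compactness. *)
pose F := filter_from [set a : R | (a%:E < s)%E]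
   (fun a => [set b : R | a <= b /\ (b%:E < s)%E]).
have FF : Filter F.
  apply: filter_from_filter; first by have [a _ ?] := btw _ Zz0; exists a.
  move=> a b /= as_ bs; exists (Num.max a b); first by rewrite /= /Num.max; case: ifP.
  move=> c /=; rewrite ge_max => -[/andP[? ?] ?]; by [].
have cov x : Z x -> \forall x' \near x & b \near F, Z x' -> (phi x' < b%:E)%E.
  move=> Zx; have [a xa as_] := btw x Zx.
  exists ([set w | Z w -> (phi w < a%:E)%E], [set b : R | a <= b /\ (b%:E < s)%E]).
    by split => /=; [exact: usc|exists a].
  by move=> [w b] /= [h [ab bs]] Zw; rewrite (lt_le_trans (h Zw))// lee_fin.
have [a /= as_ ha] := (compact_near_coveringP Z).1 cZ _ F
   (fun b w => Z w -> (phi w < b%:E)%E) FF cov.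
have : (s <= a%:E)%E.
  apply: ge_ereal_sup => _ [w Zw <-]; apply/ltW.
  by apply: (ha a) => //; split.
by rewrite leNgt as_.
Qed.

(** * Circle means and the maximum principle *)

Section integral_mono.
Local Open Scope ereal_scope.

(* The integral is a difference of two suprema over simple functions, hence
   monotone without any measurability assumption. *)
Lemma le_integral_nonmeasurable (dd : measure_display) (T : measurableType dd)
    (R : realType) (mu : {measure set T -> \bar R}) (D : set T)
    (f g : T -> \bar R) :
  (forall x, D x -> f x <= g x) ->
  \int[mu]_(x in D) f x <= \int[mu]_(x in D) g x.
Proof.
move=> fg; have {}fg x : (f \_ D) x <= (g \_ D) x.
  by rewrite !patchE; case: ifPn => //; rewrite inE; exact: fg.
rewrite /integral; apply: leeB; apply: ereal_sup_le => _ [h hf <-];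
  exists h => //= x; apply: le_trans (hf x) _; rewrite ?(funeposE, funenegE).
  by apply: le_max2.
by apply: le_max2; rewrite ?leeN2.
Qed.
End integral_mono.

Section circle_means.
Context {R : realType}.
Implicit Types (z w : R[i]).

(** There is an explicit antiderivative [F] whose trigonometric terms agree at 0 and 2 pi, so only
    the mean [k] survives. *)
Lemma integral_trig (k a b c e : R) :
  (\int[lebesgue_measure]_(t in `[0%R, (2 * pi)%R])
     (k + a * cos t + b * sin t + c * (cos t ^+ 2 - sin t ^+ 2)
       + e * (sin t * cos t))%:E = (2 * pi * k)%:E)%E.
Proof.
pose F := fun t : R => k * t + a * sin t - b * cos t + c * (sin t * cos t)
   + e / 2 * (sin t ^+ 2).
pose f := fun t : R => k + a * cos t + b * sin t + c * (cos t ^+ 2 - sin t ^+ 2)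
       + e * (sin t * cos t).
have dF (t : R) : is_derive t 1 F (f t).
  rewrite /F /f; apply: is_derive_eq.
  by rewrite -!/(_ *: _) /GRing.scale /=; field.
have cF : continuous F.
  by move=> t; apply: differentiable_continuous; apply/derivable1_diffP.
have cf : continuous f.
  move=> t; apply: differentiable_continuous; apply/derivable1_diffP.
  by rewrite /f; apply: ex_derive.
rewrite (@continuous_FTC2 _ f F).
- rewrite /F -EFinB; congr (_%:E).
  rewrite mulrC (mulr_natl pi) cos2pi sin2pi cos0 sin0; ring.
- by rewrite mulr_gt0// pi_gt0.
- by apply: continuous_subspaceT.
- split.
  + by move=> x _; apply: ex_derive.
  + by apply: cvg_at_right_filter; exact: cF.
  + by apply: cvg_at_left_filter; exact: cF.
- by move=> x _; rewrite derive1E derive_val.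
Qed.
End circle_means.

(** The difference [h] of the two sides has derivative t^3 / (1 + t), which has the sign of t, so
    [h] is smallest at 0. *)
Lemma ln1D_le {R : realType} (y : R) : -1 < y -> ln (1 + y) <= y - y ^+ 2 / 2 + y ^+ 3 / 3.
Proof.
move=> y1.
pose h := fun t : R => t - t ^+ 2 / 2 + t ^+ 3 / 3 - ln (1 + t).
pose h' := fun t : R => t ^+ 3 / (1 + t).
have dh (t : R) : -1 < t -> is_derive t 1 h (h' t).
  move=> t1; rewrite /h /h'.
  have t0 : 0 < 1 + t by lra.
  have dl : is_derive t 1 (fun x : R => ln (1 + x)) (1 + t)^-1.
    rewrite -[(1 + t)^-1]mulr1; apply: (@is_derive1_comp R (@ln R) (fun x => 1 + x)).
      exact: is_derive1_ln.
    by rewrite -[X in is_derive _ _ _ X]add0r; apply: is_deriveD.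
  apply: is_derive_eq; rewrite -!/(_ *: _) /GRing.scale /=; field.
  by rewrite lt0r_neq0.
have ch (a b : R) : -1 < a -> {within `[a, b], continuous h}.
  move=> a1; apply: derivable_within_continuous => x; rewrite in_itv/= => /andP[ax _].
  by case: (dh x (lt_le_trans a1 ax)).
suff : h 0 <= h y by rewrite /h addr0 ln1; lra.
rewrite -subr_ge0; have [y0|y0] := leP 0 y.
  have [||c] := @MVT_segment R h h' 0 y y0.
  - by move=> x; rewrite in_itv/= => /andP[x0 _]; apply: dh; lra.
  - by apply: ch; lra.
  rewrite in_itv/= => /andP[c0 _] ->; rewrite subr0 mulr_ge0// /h'.
  by rewrite divr_ge0 ?exprn_ge0//; lra.
have [||c] := @MVT_segment R h h' y 0 (ltW y0).
- by move=> x; rewrite in_itv/= => /andP[x0 _]; apply: dh; lra.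
- exact: ch.
rewrite in_itv/= => /andP[yc c0] e.
have : h 0 - h y <= 0.
  rewrite e sub0r mulr_le0_ge0 ?oppr_ge0 ?(ltW y0)// /h' exprS.
  apply: mulr_le0_ge0; last by rewrite invr_ge0; lra.
  by apply: mulr_le0_ge0; rewrite ?sqr_ge0.
lra.
Qed.

(** * Second-order upper bounds on small circles *)

Section harmonic_upper_bounds.
Context {R : realType}.
Implicit Types (z w : R[i]) (h : R[i] -> R).

(* On small circles around z, h is at most h z plus a zero-mean trigonometric
   polynomial, up to a cubic error in the radius; this is the form in which the
   harmonicity of ln |z - w| is used. *)
Definition harmonic_ub h z := exists a b c e k r0 : R, 0 < r0 /\
  forall r t : R, 0 < r -> r <= r0 ->
  h (circle_point z r t) <= h z + r * (a * cos t + b * sin t)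
    + r ^+ 2 * (c * (cos t ^+ 2 - sin t ^+ 2) + e * (sin t * cos t))
    + k * r ^+ 3.

Lemma harmonic_ub_cst (x : R) z : harmonic_ub (fun=> x) z.
Proof.
by exists 0, 0, 0, 0, 0, 1; split => // r t _ _; rewrite !mul0r !addr0 !mulr0 !addr0.
Qed.

Lemma harmonic_ubD h1 h2 z : harmonic_ub h1 z -> harmonic_ub h2 z ->
  harmonic_ub (fun w => h1 w + h2 w) z.
Proof.
move=> [a1 [b1 [c1 [e1 [k1 [r1 [r10 H1]]]]]]] [a2 [b2 [c2 [e2 [k2 [r2 [r20 H2]]]]]]].
exists (a1 + a2), (b1 + b2), (c1 + c2), (e1 + e2), (k1 + k2), (Num.min r1 r2).
split=> [|r t r0]; first by rewrite lt_min r10.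
rewrite le_min => /andP[/(H1 _ t r0) h1r /(H2 _ t r0) h2r].
by apply: le_trans (lerD h1r h2r) _; rewrite le_eqVlt; apply/orP/or_introl/eqP; ring.
Qed.

Lemma harmonic_ubZ h x z : 0 <= x -> harmonic_ub h z ->
  harmonic_ub (fun w => x * h w) z.
Proof.
move=> x0 [a [b [c [e [k [r0 [r00 H]]]]]]].
exists (x * a), (x * b), (x * c), (x * e), (x * k), r0; split => // r t r1 rr.
apply: le_trans (ler_wpM2l x0 (H r t r1 rr)) _.
by rewrite le_eqVlt; apply/orP/or_introl/eqP; ring.
Qed.

Lemma harmonic_ub_sum (S : seq R[i]) (F : R[i] -> R[i] -> R) z :
  (forall w, w \in S -> harmonic_ub (F w) z) ->
  harmonic_ub (fun y => \sum_(w <- S) F w y) z.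
Proof.
elim: S => [|w S ih] H.
  rewrite (_ : (fun _ => _) = (fun=> 0)); first exact: harmonic_ub_cst.
  by apply/funext => y; rewrite big_nil.
rewrite (_ : (fun _ => _) = (fun y => F w y + \sum_(w <- S) F w y)); last first.
  by apply/funext => y; rewrite big_cons.
apply: harmonic_ubD; first by apply: H; rewrite mem_head.
by apply: ih => y yS; apply: H; rewrite in_cons yS orbT.
Qed.

Lemma ln_normcE z : z != 0 ->
  ln (normc z) = ln (complex.Re z ^+ 2 + complex.Im z ^+ 2) / 2.
Proof.
move=> z0; have n0 := normc_gt0 z0.
have -> : complex.Re z ^+ 2 + complex.Im z ^+ 2 = normc z ^+ 2.
  by case: z {z0 n0} => p q /=; rewrite sqr_sqrtr// addr_ge0 ?sqr_ge0.
by rewrite lnXn//; field.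
Qed.

Lemma sqn_gt0 (p q : R) : p +i* q != 0 -> 0 < p ^+ 2 + q ^+ 2.
Proof.
move=> h; rewrite lt_neqAle addr_ge0 ?sqr_ge0// andbT eq_sym.
apply: contra h; rewrite paddr_eq0 ?sqr_ge0// !sqrf_eq0 => /andP[/eqP-> /eqP->].
by [].
Qed.

(** With P = |z - w|^2, the squared distance from the circle point to [w] is P (1 + y), where y = (2
    r u + r^2) / P and u = p cos t + q sin t. Expanding ln (1 + y) by [ln1D_le], the terms of order
    r and r^2 have zero mean and everything else is O(r^3). *)
Lemma harmonic_ub_ln w z : z != w ->
  harmonic_ub (fun y => ln (normc (y - w))) z.
Proof.
case: w z => [w1 w2] [z1 z2]; rewrite -subr_eq0.
set p := z1 - w1; set q := z2 - w2; set P := p ^+ 2 + q ^+ 2.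
rewrite (_ : _ - _ = p +i* q)// => pq0.
have P0 : 0 < P by exact: sqn_gt0.
set m := `|p| + `|q|; have m0 : 0 <= m by rewrite addr_ge0.
set K := (2 * m + 1) / P; have K0 : 0 < K by rewrite divr_gt0//; lra.
(* The first four coefficients are read off the expansion. The cubic constant bounds -r^3 u / P^2 by
   |u| <= m, and y^3 / 6 by |y| <= r K. The radius bound makes this last estimate valid (r <= 1) and
   keeps |y| <= 1/2. *)
exists (p / P), (q / P), ((q ^+ 2 - p ^+ 2) / (2 * P ^+ 2)),
  (- 2 * p * q / P ^+ 2), (m / P ^+ 2 + K ^+ 3 / 6), (Num.min 1 (K^-1 / 2)).
split; first by rewrite lt_min ltr01 /= divr_gt0 ?invr_gt0.
move=> r t r0; rewrite le_min => /andP[r1 rK].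
have {}rK : r * K <= 2^-1.
  by rewrite -ler_pdivlMr// mulrC.
set u := p * cos t + q * sin t.
have um : `|u| <= m.
  rewrite (le_trans (ler_normD _ _))// !normrM lerD// ler_piMr// ler_norml.
    by rewrite cos_geN1 cos_le1.
  by rewrite sin_geN1 sin_le1.
set y := (2 * r * u + r ^+ 2) / P.
have yK : `|y| <= r * K.
  rewrite /y /K normrM (ger0_norm (x := P^-1)) ?invr_ge0 ?(ltW P0)// mulrA.
  rewrite ler_pM2r ?invr_gt0// (le_trans (ler_normD _ _))//.
  rewrite (ger0_norm (sqr_ge0 r)) normrM (ger0_norm (x := 2 * r)); last lra.
  have : r * `|u| <= r * m by rewrite ler_pM2l.
  have : r ^+ 2 <= r by rewrite expr2 ler_piMr// ltW.
  lra.
have y1 : -1 < y by move: (le_trans yK rK); rewrite ler_norml; lra.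
have Q0 : 0 < P * (1 + y) by rewrite mulr_gt0//; lra.
have QE : (p + r * cos t) ^+ 2 + (q + r * sin t) ^+ 2 = P * (1 + y).
  rewrite /y mulrDr mulr1 mulrCA divff ?lt0r_neq0// mulr1 /P /u.
  have := cos2Dsin2 t; set c := cos t; set s := sin t => e.
  rewrite (_ : _ + _ = p ^+ 2 + q ^+ 2 + 2 * r * (p * c + q * s) +
    r ^+ 2 * (c ^+ 2 + s ^+ 2)); last ring.
  by rewrite e; ring.
have -> : circle_point (z1 +i* z2) r t - (w1 +i* w2) =
    (p + r * cos t) +i* (q + r * sin t).
  by rewrite /circle_point /p /q; congr (_ +i* _); rewrite /=; ring.
have pq1 : (p + r * cos t) +i* (q + r * sin t) != 0.
  apply: contraTneq Q0 => -[e1 e2].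
  by rewrite -QE e1 e2 expr0n/= addr0 ltxx.
rewrite !ln_normcE//= -/P QE lnM ?posrE//; last by lra.
have := ln1D_le y1.
have y3 : y ^+ 3 <= r ^+ 3 * K ^+ 3.
  rewrite -exprMn (le_trans (ler_norm _))// normrX.
  by rewrite lerXn2r// nnegrE// mulr_ge0 ?ltW.
have ur : - (r ^+ 3 * u) <= r ^+ 3 * m.
  rewrite -mulrN ler_pM2l ?exprn_gt0//.
  by move: um; rewrite ler_norml; lra.
have P20 : 0 < P ^+ 2 by rewrite exprn_gt0.
have ur' : - (r ^+ 3 * u) / P ^+ 2 <= r ^+ 3 * m / P ^+ 2.
  by rewrite ler_pM2r ?invr_gt0.
have : y - y ^+ 2 / 2 = 2 * r * (u / P)
   + r ^+ 2 * ((P - 2 * u ^+ 2) / P ^+ 2)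
   + 2 * (- (r ^+ 3 * u) / P ^+ 2) - (r ^+ 2 / P) ^+ 2 / 2.
  by rewrite /y; field; rewrite lt0r_neq0.
(* This is where harmonicity of the logarithm enters: the coefficient of r^2 is a trigonometric
   polynomial without constant term. *)
have -> : P - 2 * u ^+ 2 = (q ^+ 2 - p ^+ 2) * (cos t ^+ 2 - sin t ^+ 2)
    - 4 * p * q * (sin t * cos t).
  have -> : P = P * (cos t ^+ 2 + sin t ^+ 2) by rewrite cos2Dsin2 mulr1.
  by rewrite /P /u; ring.
have := sqr_ge0 (r ^+ 2 / P).
have -> : r ^+ 2 * (((q ^+ 2 - p ^+ 2) * (cos t ^+ 2 - sin t ^+ 2)
    - 4 * p * q * (sin t * cos t)) / P ^+ 2) = 2 * (r ^+ 2 *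
   ((q ^+ 2 - p ^+ 2) / (2 * P ^+ 2) * (cos t ^+ 2 - sin t ^+ 2) +
    -2 * p * q / P ^+ 2 * (sin t * cos t))).
  by field; rewrite lt0r_neq0.
have -> : r * (p / P * cos t + q / P * sin t) = r * (u / P).
  by rewrite /u; field; rewrite lt0r_neq0.
set T1 := r * (u / P); set T2 := r ^+ 2 * (_ + _); set T3 := _ ^+ 2.
set T4 := - (r ^+ 3 * u) / _ in ur' *.
rewrite (_ : (m / P ^+ 2 + K ^+ 3 / 6) * r ^+ 3 =
  r ^+ 3 * m / P ^+ 2 + r ^+ 3 * K ^+ 3 / 6); last first.
  by field; rewrite lt0r_neq0.
rewrite (_ : 2 * r * (u / P) = 2 * T1); last by rewrite -mulrA.
move: ur' y3; set y3 := y ^+ 3; set K3 := r ^+ 3 * K ^+ 3.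
set M := r ^+ 3 * m / P ^+ 2.
move: (y - _ / 2) => W; move: (ln P) (ln (1 + y)) => X1 X2.
clearbody T1 T2 T3 T4 y3 K3 M; clear; lra.
Qed.

End harmonic_upper_bounds.

(** * The maximum principle with a quadratic penalty *)

Section maximum_principle.
Context {R : realType}.
Variables (U : set R[i]) (f : R[i] -> \bar R).
Hypotheses (oU : open U) (hf : subharmonic U f).
Implicit Types (z w x : R[i]) (h : R[i] -> R).

Lemma normc_circle z r t : 0 <= r -> normc (circle_point z r t - z) = r.
Proof.
move=> r0; rewrite /circle_point addrAC subrr add0r /=.
rewrite !exprMn -mulrDr cos2Dsin2 mulr1 sqrtr_sqr ger0_norm//.
Qed.

Lemma normc_circleB z x r t : normc (circle_point z r t - x) ^+ 2 =
  normc (z - x) ^+ 2 + 2 * r * (complex.Re (z - x) * cos t +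
    complex.Im (z - x) * sin t) + r ^+ 2.
Proof.
case: z x => [z1 z2] [x1 x2]; rewrite /circle_point /=.
rewrite !sqr_sqrtr ?addr_ge0 ?sqr_ge0//.
have <- : r ^+ 2 * (cos t ^+ 2 + sin t ^+ 2) = r ^+ 2 by rewrite cos2Dsin2 mulr1.
by ring.
Qed.

(** Averaging the bound over a circle of radius r kills the zero-mean terms and leaves fz + k r^3 -
    e r^2. For small r this is below fz, against the submean inequality. *)
Lemma subharmonic_no_strict_max h z x (fz e rho : R) :
  f z = fz%:E -> harmonic_ub h z -> 0 < e -> 0 < rho ->
  closed_disc z rho `<=` U ->
  (forall w, closed_disc z rho w -> (f w <=
    (fz + (h w - h z) - e * (normc (w - x) ^+ 2 - normc (z - x) ^+ 2))%:E)%E) ->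
  False.
Proof.
move=> fzE [a [b [c [s [k [r0 [r00 H]]]]]]] e0 rho0 zU fle.
(* The last term forces [k * r < e], so the quadratic gain beats the cubic error. *)
pose r := Num.min (Num.min rho r0) (e / (2 * (`|k| + 1))).
have k0 : 0 < `|k| + 1 by rewrite ltr_wpDl.
have r1 : 0 < r by rewrite !lt_min rho0 r00 divr_gt0// mulr_gt0.
have rrho : r <= rho by rewrite /r !ge_min lexx.
have rr0 : r <= r0 by rewrite /r !ge_min lexx orbT.
have rk : k * r < e.
  apply: (@le_lt_trans _ _ ((`|k| + 1) * r)).
    by rewrite ler_pM2r//; have := ler_norm k; lra.
  rewrite mulrC -ltr_pdivlMr//.
  apply: (@le_lt_trans _ _ (e / (2 * (`|k| + 1)))); first by rewrite /r ge_min lexx orbT.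
  by rewrite ltr_pM2l// ltf_pV2 ?posrE ?mulr_gt0//; lra.
have rU : closed_disc z r `<=` U.
  by move=> w; rewrite /closed_disc /= => wr; apply: zU; exact: le_trans wr rrho.
set p := complex.Re (z - x); set q := complex.Im (z - x).
have := subharmonic_submean hf r1 rU; rewrite fzE.
have : (\int[lebesgue_measure]_(theta in `[0%R, (2 * pi)%R])
          f (circle_point z r theta) <=
  \int[lebesgue_measure]_(t in `[0%R, (2 * pi)%R])
   (fz + k * r ^+ 3 - e * r ^+ 2 + (r * a - 2 * e * r * p) * cos t
     + (r * b - 2 * e * r * q) * sin t + (r ^+ 2 * c) * (cos t ^+ 2 - sin t ^+ 2)
     + (r ^+ 2 * s) * (sin t * cos t))%:E)%E.
  apply: le_integral_nonmeasurable => t _.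
  apply: le_trans (fle _ _) _.
    by rewrite /closed_disc /= normc_circle// ltW.
  rewrite lee_fin normc_circleB -/p -/q.
  by have := H r t r1 rr0; lra.
rewrite integral_trig => le1 le2.
have pi0 : (0 : R) < 2 * pi by rewrite mulr_gt0// pi_gt0.
have := le_trans le2 (lee_wpmul2l _ le1).
rewrite lee_fin invr_ge0 (ltW pi0) => /(_ isT).
rewrite -EFinM lee_fin mulKf ?lt0r_neq0//.
have : r ^+ 2 * (k * r) < r ^+ 2 * e by rewrite ltr_pM2l ?exprn_gt0.
rewrite mulrCA -exprSr; lra.
Qed.

(** The penalised difference [f - h + e |w - x|^2] attains its maximum over the compact set [Z]. An
    interior maximum with finite value is impossible by [subharmonic_no_strict_max]; elsewhere
    [f <= h] bounds the maximum by e b^2. Then e tends to 0. *)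
Lemma max_principle h (Z : set R[i]) x b :
  closed Z -> Z `<=` closed_disc x b -> Z `<=` U ->
  (forall z, Z z -> harmonic_ub h z) ->
  (forall z, Z z -> h w @[w --> z] --> h z) ->
  (forall z, Z z -> (f z <= (h z)%:E)%E \/ exists2 r, 0 < r & closed_disc z r `<=` Z) ->
  forall z, Z z -> (f z <= (h z)%:E)%E.
Proof.
move=> cZ Zb ZU hub hc ZP z1 Zz1.
have b0 : 0 <= b by apply: le_trans (normc_ge0 _) (Zb _ Zz1).
(* The penalty is rescaled by b^2 + 1 rather than b^2, since b may be 0. *)
suff key (e : R) : 0 < e -> (f z1 <= (h z1 + e * b ^+ 2)%:E)%E.
  apply/lee_addgt0Pr => e e0; rewrite -EFinD.
  apply: le_trans (key (e / (b ^+ 2 + 1)) _) _.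
    by rewrite divr_gt0// ltr_wpDl// sqr_ge0.
  rewrite lee_fin lerD2l mulrAC ler_pdivrMr ?ltr_wpDl ?sqr_ge0//.
  by rewrite ler_pM2l//; lra.
move=> e0.
pose g w := e * normc (w - x) ^+ 2 - h w.
have gc z : Z z -> g w @[w --> z] --> g z.
  move=> Zz; have FFz : ProperFilter (nbhs z) := nbhs_pfilter z.
  apply: (@cvgB _ _ _ _ (nbhs_filter z)); last exact: hc.
  apply: (@cvgM _ _ _ (nbhs_filter z) (fun=> e)); first exact: cvg_cst.
  have nc := @cvg_normc _ z x.
  exact: (@cvgM _ _ _ (nbhs_filter z) _ _ _ _ nc nc).
pose phi w := (f w + (g w)%:E)%E.
have [|||z Zz zmax] := @usc_attains_max R _ Z phi.
- exact: closed_disc_compact cZ Zb.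
- by exists z1.
- move=> z a Zz zlt.
  have [s fs sg] : exists2 s : R, (f z < s%:E)%E & s + g z < a.
    move: zlt; rewrite /phi; have := subharmonic_lty hf (ZU _ Zz).
    case: (f z) => [u _| |_ _] //.
      rewrite -EFinD lte_fin => ua; exists (u + (a - (u + g z)) / 2); rewrite ?lte_fin; lra.
    by exists (a - g z - 1); rewrite ?ltNyr//; lra.
  have gnear : \forall w \near z, g w < a - s.
    by have := gc z Zz; move/cvgr_lt; apply; lra.
  have fnear := subharmonic_usc hf (ZU _ Zz) fs.
  near=> w => Zw.
  have fw : (f w < s%:E)%E by apply: (near fnear w) => //; exact: ZU.
  have gw : g w < a - s by near: w.
  apply: (@lt_le_trans _ _ (s%:E + (a - s)%:E)%E); last first.
    by rewrite -EFinD lee_fin; lra.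
  by apply: lteD; rewrite ?lte_fin.
have bnd (w : R[i]) : Z w -> e * normc (w - x) ^+ 2 <= e * b ^+ 2.
  move=> Zw; rewrite ler_pM2l// lerXn2r// ?nnegrE ?normc_ge0//; exact: Zb.
have {}zmax w (Zw : Z w) : (f w <= phi z - (g w)%:E)%E.
  by rewrite leeBrDr//; exact: zmax.
have fin : (phi z <= (e * b ^+ 2)%:E)%E -> (f z1 <= (h z1 + e * b ^+ 2)%:E)%E.
  move=> le; apply: le_trans (zmax _ Zz1) _; rewrite leeBlDr//.
  apply: le_trans le _; rewrite -EFinD lee_fin /g.
  have : 0 <= e * normc (z1 - x) ^+ 2 by rewrite mulr_ge0 ?sqr_ge0// ltW.
  lra.
case: (ZP z Zz) => [fh|[r r0 rZ]].
  apply: fin; rewrite /phi /g; apply: le_trans (leeD2r _ fh) _.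
  by rewrite -EFinD lee_fin; have := bnd z Zz; lra.
(* At an interior maximum, the value -oo makes [phi] equal to -oo on all of [Z], and [fin] applies;
   a finite value is contradictory. *)
have := subharmonic_lty hf (ZU _ Zz).
case fz : (f z) => [u| |] // _; last by apply: fin; rewrite /phi fz leNye.
exfalso; apply: (@subharmonic_no_strict_max h z x u e r) => //.
- exact: hub.
- exact: subset_trans rZ ZU.
- move=> w /rZ Zw; apply: le_trans (zmax _ Zw) _.
  rewrite /phi fz -!EFinD lee_fin /g; lra.
Unshelve. all: by end_near. Qed.

End maximum_principle.

(** * Logarithmic majorants and doubling *)

Section log_majorants.
Context {R : realType}.
Variables (U : set R[i]) (f : R[i] -> \bar R).
Hypotheses (oU : open U) (hf : subharmonic U f).
Implicit Types (z w x : R[i]).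

Lemma closed_closed_disc x (r : R) : closed (closed_disc x r).
Proof.
rewrite (_ : closed_disc x r = ~` [set z | r < normc (z - x)]); last first.
  apply/seteqP; split => z /=; rewrite /closed_disc /=;
    by [rewrite leNgt => /negP|move/negP; rewrite -leNgt].
apply: open_closedC; rewrite openE => z /= zr; apply/nbhs_disc.
exists (normc (z - x) - r); first by rewrite subr_gt0.
move=> w; rewrite /disc /= => wz.
by have := normcB_triangle w z x; rewrite (normc_distC z w); lra.
Qed.

Lemma closed_ge_normc x (r : R) : closed [set z | r <= normc (z - x)].
Proof.
rewrite (_ : [set z | _] = ~` disc x r); first exact: open_closedC (@open_disc _ x r).
apply/seteqP; split => z /=; rewrite /disc /=;
  by [rewrite leNgt => /negP|move/negP; rewrite -leNgt].
Qed.

(** All comparison functions below have this form: a constant plus a nonnegative multiple of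
    logarithms with poles off [Z], hence continuous on [Z] and with harmonic upper bounds there. *)
Lemma max_principle_log (S : seq R[i]) (k c : R) (Z : set R[i]) x b :
  0 <= c -> closed Z -> Z `<=` closed_disc x b -> Z `<=` U ->
  (forall z w, Z z -> w \in S -> z != w) ->
  (forall z, Z z -> (f z <= (k + c * \sum_(w <- S) ln (normc (z - w)))%:E)%E \/
    exists2 r, 0 < r & closed_disc z r `<=` Z) ->
  forall z, Z z -> (f z <= (k + c * \sum_(w <- S) ln (normc (z - w)))%:E)%E.
Proof.
move=> c0 cZ Zb ZU ZS ZP.
apply: (@max_principle R U f hf
  (fun z => k + c * \sum_(w <- S) ln (normc (z - w))) Z x b) => //.
  move=> z Zz; apply: harmonic_ubD; first exact: harmonic_ub_cst.
  apply: harmonic_ubZ => //.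
  apply: (@harmonic_ub_sum _ S (fun w y => ln (normc (y - w)))) => w wS.
  by apply: harmonic_ub_ln; exact: ZS.
move=> z Zz; have FFz : ProperFilter (nbhs z) := nbhs_pfilter z.
apply: (@cvgD _ _ _ _ (nbhs_filter z) (fun=> k)); first exact: cvg_cst.
apply: (@cvgM _ _ _ (nbhs_filter z) (fun=> c)); first exact: cvg_cst.
elim: S ZS {ZP} => [|w S ih] ZS.
  rewrite big_nil; under eq_fun do rewrite big_nil.
  exact: cvg_cst.
rewrite big_cons; under eq_fun do rewrite big_cons.
apply: (@cvgD _ _ _ _ (nbhs_filter z)).
  apply: cvg_comp (@cvg_normc _ z w) _.
  by apply: continuous_ln; rewrite normc_gt0// subr_eq0 ZS// mem_head.
by apply: ih => y v Zy vS; apply: ZS => //; rewrite in_cons vS orbT.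
Qed.

(** Hadamard's three circles: the single pole is [x], and the slope (B - m) / ln (r / t) makes the
    majorant equal to m on the inner circle and to B on the outer one. *)
Lemma subharmonic_annulus x (t r B m : R) :
  0 < t -> t < r -> closed_disc x r `<=` U ->
  (forall z, closed_disc x r z -> (f z <= B%:E)%E) ->
  (forall z, closed_disc x t z -> (f z <= m%:E)%E) -> m <= B ->
  forall z, t <= normc (z - x) -> normc (z - x) <= r ->
  (f z <= (m + (B - m) / ln (r / t) * ln (normc (z - x) / t))%:E)%E.
Proof.
move=> t0 tr rU fB fm mB z zt zr.
have rt : 0 < ln (r / t) by rewrite ln_gt0// ltr_pdivlMr// mul1r.
set c := (B - m) / _; have c0 : 0 <= c by rewrite divr_ge0 ?subr_ge0// ltW.
pose Z := closed_disc x r `&` [set z | t <= normc (z - x)].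
have hE y : Z y -> m - c * ln t + c * \sum_(w <- [:: x]) ln (normc (y - w)) =
    m + c * ln (normc (y - x) / t).
  move=> -[_ /= yt]; have y0 := lt_le_trans t0 yt.
  by rewrite big_seq1 ln_div ?posrE//; ring.
rewrite -hE//; apply: (@max_principle_log [:: x] _ c Z x r) => //.
- by apply: closedI; [exact: closed_closed_disc|exact: closed_ge_normc].
- by move=> y [].
- by move=> y [/rU].
- move=> y w [_ /= yt]; rewrite inE => /eqP ->; apply: contraTneq yt => ->.
  by rewrite normcBxx -ltNge.
- move=> y Zy; have [yr yt] := Zy; move: yr yt; rewrite /closed_disc /= => yr yt.
  have [yt'|yt'] := leP (normc (y - x)) t.
    left; rewrite hE// (_ : normc (y - x) = t); last by apply/eqP; rewrite eq_le yt' yt.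
    by rewrite divff ?lt0r_neq0// ln1 mulr0 addr0; apply: fm.
  have [yr'|yr'] := leP r (normc (y - x)).
    left; rewrite hE// (_ : normc (y - x) = r); last by apply/eqP; rewrite eq_le yr' yr.
    by rewrite /c divfK ?lt0r_neq0// (_ : m + _ = B); [apply: fB|ring].
  right; exists (Num.min (normc (y - x) - t) (r - normc (y - x))).
    by rewrite lt_min !subr_gt0 yt' yr'.
  move=> w; rewrite /closed_disc /= le_min => /andP[w1 w2].
  have := normcB_triangle w y x; have := normcB_triangle y w x.
  by rewrite (normc_distC y w) => ? ?; split; rewrite /closed_disc /=; lra.
Qed.

Section doubling.
Variables (x z0 : R[i]) (t r A B m : R).
Hypotheses (t0 : 0 < t) (tr : t <= r) (rU : closed_disc x (4 * r) `<=` U)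
  (fB : forall z, closed_disc x (4 * r) z -> (f z <= B%:E)%E)
  (z0r : normc (z0 - x) <= r) (fz0 : ((- A)%:E <= f z0)%E)
  (fm : forall z, closed_disc x t z -> (f z <= m%:E)%E).

Let AB : 0 <= A + B.
Proof.
have : ((- A)%:E <= B%:E)%E.
  have r0 := lt_le_trans t0 tr.
  by apply: le_trans fz0 (fB _); apply: le_trans z0r _; lra.
by rewrite lee_fin; lra.
Qed.

Let ln4 : 0 < ln 4 :> R.
Proof. by rewrite ln_gt0//; lra. Qed.

Let L4 : ln 4 <= ln (4 * r / t).
Proof.
rewrite ler_ln ?posrE ?divr_gt0 ?mulr_gt0//; last exact: lt_le_trans tr.
by rewrite ler_pdivlMr// ler_pM2l.
Qed.

(** The three-circle bound is evaluated at [z0], where f >= -A. Since [z0] is within r of the centre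
    while the outer radius is 4r, the majorant there is at least ln 4 times its slope below B. Hence
    f cannot be too negative on the whole small disc. *)
Lemma doubling_lower : B - m <= (A + B) * (ln (4 * r / t) / ln 4).
Proof.
have r0 := lt_le_trans t0 tr.
have L0 : 0 < ln (4 * r / t) := lt_le_trans ln4 L4.
have [mB|/ltW mB] := leP m B; last first.
  by apply: (@le_trans _ _ 0); rewrite ?subr_le0// mulr_ge0// divr_ge0// ltW.
have [z0t|z0t] := leP (normc (z0 - x)) t.
  have : ((- A)%:E <= m%:E)%E by apply: le_trans fz0 (fm _).
  rewrite lee_fin => mA; apply: (@le_trans _ _ (A + B)); first by lra.
  by rewrite ler_peMr// ler_pdivlMr// mul1r.
have tr4 : t < 4 * r by apply: (le_lt_trans tr); lra.
have z0r4 : normc (z0 - x) <= 4 * r by apply: (le_trans z0r); lra.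
have := le_trans fz0 (subharmonic_annulus t0 tr4 rU fB fm mB (ltW z0t) z0r4).
rewrite lee_fin => le1.
have le2 : ln (normc (z0 - x) / t) <= ln (4 * r / t) - ln 4.
  rewrite -ln_div ?posrE ?divr_gt0//; last by rewrite mulr_gt0.
  rewrite ler_ln ?posrE ?divr_gt0 ?mulr_gt0//; last exact: lt_trans z0t.
  have -> : 4 * r / t / 4 = r / t by field; rewrite lt0r_neq0.
  by rewrite ler_pM2r ?invr_gt0.
have c0 : 0 <= (B - m) / ln (4 * r / t) by rewrite divr_ge0 ?subr_ge0// ltW.
have := ler_wpM2l c0 le2; rewrite mulrBr divfK ?lt0r_neq0// => le3.
have : (B - m) / ln (4 * r / t) * ln 4 <= A + B by lra.
by rewrite mulrAC ler_pdivrMr// -ler_pdivlMr// mulrA.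
Qed.

(** By [doubling_lower] the slope of the three-circle majorant is at most (A + B) / ln 4, so passing
    from radius t to 4t adds at most A + B, whatever t is. *)
Lemma doubling z : closed_disc x (4 * t) z -> (f z <= (m + (A + B))%:E)%E.
Proof.
rewrite /closed_disc /= => z4t; have r0 := lt_le_trans t0 tr; have AB0 := AB.
have L0 : 0 < ln (4 * r / t) := lt_le_trans ln4 L4.
have z4r : normc (z - x) <= 4 * r.
  by apply: (le_trans z4t); rewrite ler_pM2l.
have [mB|/ltW mB] := leP m B; last first.
  by apply: le_trans (fB z4r) _; rewrite lee_fin; lra.
have [zt|zt] := leP (normc (z - x)) t.
  by apply: le_trans (fm zt) _; rewrite lee_fin; lra.
have tr4 : t < 4 * r by apply: (le_lt_trans tr); lra.
apply: le_trans (subharmonic_annulus t0 tr4 rU fB fm mB (ltW zt) z4r) _.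
rewrite lee_fin lerD2l.
have c0 : 0 <= (B - m) / ln (4 * r / t) by rewrite divr_ge0 ?subr_ge0// ltW.
apply: (@le_trans _ _ ((B - m) / ln (4 * r / t) * ln 4)).
  apply: ler_wpM2l => //; rewrite ler_ln ?posrE ?divr_gt0//; last exact: lt_trans zt.
  by rewrite ler_pdivrMr.
by rewrite mulrAC ler_pdivrMr// -ler_pdivlMr// -mulrA; exact: doubling_lower.
Qed.

End doubling.
End log_majorants.

(** * Finiteness on a dense set and uniform bounds on a compact set *)

Section finiteness.
Context {R : realType}.
Variables (U : set R[i]) (f : R[i] -> \bar R).
Hypotheses (oU : open U) (hf : subharmonic U f).
Implicit Types (z w x : R[i]).

Lemma subharmonic_locally_bounded z : U z ->
  exists2 r : R, 0 < r & exists B : R, disc z r `<=` U /\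
    forall w, disc z r w -> (f w <= B%:E)%E.
Proof.
move=> Uz; have [B fB] : exists B : R, (f z < B%:E)%E.
  case: (f z) (subharmonic_lty hf Uz) => [u _| |_] //.
    by exists (u + 1); rewrite lte_fin ltrDl.
  by exists 0; rewrite ltNyr.
have /nbhs_disc[r r0 rU] : nbhs z U by move: oU; rewrite openE; apply.
have /nbhs_disc[s s0 sB] := subharmonic_usc hf Uz fB.
exists (Num.min r s); first by rewrite lt_min r0.
exists B; split=> w; rewrite /disc /= lt_min => /andP[wr ws]; first exact: rU.
by apply/ltW/(sB w ws)/rU.
Qed.

Lemma open_sublevel (c : R) : open [set z | U z /\ (f z < c%:E)%E].
Proof.
rewrite openE => z [Uz fz].
have n1 : nbhs z U by move: oU; rewrite openE; apply.
have n2 := subharmonic_usc hf Uz fz.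
by near=> w; split; [near: w|have := near n2 w; apply => //; near: w].
Unshelve. all: by end_near. Qed.

(** If f is -oo near [v], every real m bounds it on a small disc around [v], so [doubling_lower]
    excludes a point nearby with f > -oo. The radius does not depend on [v]; this gives closedness
    of the set where f is locally -oo. *)
Lemma ninfty_spread z : U z -> exists2 r : R, 0 < r &
  forall v (s : R), disc z r v -> 0 < s ->
  (forall w, disc v s w -> f w = -oo%E) -> forall w, disc z r w -> f w = -oo%E.
Proof.
move=> Uz; have [r r0 [B [rU fB]]] := subharmonic_locally_bounded Uz.
have r16 : 0 < r / 16 by rewrite divr_gt0.
exists (r / 16) => // v s; rewrite {1}/disc /= => vz s0 fv w; rewrite /disc /= => wz.
have wv : normc (w - v) <= r / 8.
  by have := normcB_triangle z w v; rewrite (normc_distC z v); lra.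
have vr y : closed_disc v (4 * (r / 8)) y -> disc z r y.
  rewrite /closed_disc /disc /= => yv.
  by have := normcB_triangle v y z; lra.
apply: contrapT => fw.
have [A fA] : exists A : R, ((- A)%:E <= f w)%E.
  case: (f w) fw => [u| |] // _; last by exists 0; rewrite leey.
  by exists (- u); rewrite opprK.
pose t := Num.min (s / 2) (r / 8).
have t0 : 0 < t by rewrite lt_min !divr_gt0.
have tr : t <= r / 8 by rewrite /t ge_min lexx orbT.
(* One less than the smallest bound that [doubling_lower] allows. *)
pose m := B - (A + B) * (ln (4 * (r / 8) / t) / ln 4) - 1.
have fm y : closed_disc v t y -> (f y <= m%:E)%E.
  rewrite /closed_disc /= => yt; rewrite fv ?leNye// /disc /=.
  by apply: (le_lt_trans yt); rewrite /t gt_min; apply/orP; left; lra.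
have := @doubling_lower R U f hf v w t (r / 8) A B m t0 tr
  (fun y h => rU y (vr y h)) (fun y h => fB y (vr y h)) wv fA fm.
by rewrite /m; lra.
Qed.

(** Otherwise the set [V] of points near which f is -oo meets the component of [z]. It is open, and
    relatively closed in [U] by [ninfty_spread], so it contains the whole component, against
    nontriviality. *)
Lemma subharmonic_finite_dense z (r : R) : U z -> 0 < r ->
  exists2 w, disc z r w & f w <> -oo%E.
Proof.
move=> Uz r0; apply: contrapT => none.
have fz w : disc z r w -> f w = -oo%E.
  by move=> zw; apply: contrapT => fw; apply: none; exists w.
pose V := [set y | exists2 s : R, 0 < s & forall w, disc y s w -> f w = -oo%E].
(* The exterior of [V]; on [U] its complement is exactly [V]. *)
pose W := [set y | exists2 s : R, 0 < s & disc y s `&` V = set0].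
have oV : open V.
  rewrite openE => y [s s0 ys]; apply/nbhs_disc; exists (s / 2); first by lra.
  move=> w; rewrite /disc /= => wy; exists (s / 2); first by lra.
  move=> v; rewrite /disc /= => vw; apply: ys; rewrite /disc /=.
  by have := normcB_triangle w v y; lra.
have oW : open W.
  rewrite openE => y [s s0 ys]; apply/nbhs_disc; exists (s / 2); first by lra.
  move=> w; rewrite /disc /= => wy; exists (s / 2); first by lra.
  rewrite -subset0 => v [vw Vv]; rewrite -ys; split=> //; move: vw; rewrite /disc /=.
  by have := normcB_triangle w v y; lra.
have UVW y : U y -> ~ W y -> V y.
  move=> Uy nW; have [s s0 H] := ninfty_spread Uy.
  have /set0P[v [yv [q q0 fv]]] : disc y s `&` V != set0.
    by apply/eqP => e; apply: nW; exists s.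
  by exists s => //; exact: H yv q0 fv.
have Vdisj y : V y -> ~ W y.
  move=> Vy [s s0 e]; have : set0 y by rewrite -e; split; rewrite // /disc /= normcBxx.
  by [].
pose C := connected_component U z.
have CU : C `<=` U by exact: connected_component_sub.
have Cz : C z by apply: connected_component_refl; rewrite ?inE.
have CV : C `&` V = C.
  apply: (@component_connected _ U z).
  - by exists z; split => //; exists r.
  - by exists V.
  - exists (~` W); first exact: open_closedC.
    apply/seteqP; split=> y [Cy]; first by move=> /Vdisj.
    by move=> nW; split=> //; apply: UVW => //; exact: CU.
have [w Cw fw] := subharmonic_nontrivial hf Uz.
have [_ [s s0 H]] : (C `&` V) w by rewrite CV.
by apply: fw; apply: H; rewrite /disc /= normcBxx.
Qed.

(** Local boundedness and density of the finite values are made uniform by compactness, first for r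
    and B, then for A with r fixed. *)
Lemma subharmonic_uniform (K : set R[i]) : compact K -> K `<=` U ->
  exists r A B : R, [/\ 0 < r,
    forall x, K x -> closed_disc x (4 * r) `<=` U,
    forall x z, K x -> closed_disc x (4 * r) z -> (f z <= B%:E)%E &
    forall x, K x -> exists2 z, normc (z - x) <= r & ((- A)%:E <= f z)%E].
Proof.
move=> cK KU.
have /compact_near_coveringP ncK := cK.
(* One integer governs both radius and bound: increasing it shrinks the disc and relaxes the bound,
   so the property persists for large n. *)
pose P1 (n : nat) x := closed_disc x (4 * n.+1%:R^-1) `<=` U /\
  forall z, closed_disc x (4 * n.+1%:R^-1) z -> (f z <= n%:R%:E)%E.
have [n0 _ H1] : \forall n \near \oo, K `<=` P1 n.
  apply: ncK => x Kx; have [r r0 [B [rU fB]]] := subharmonic_locally_bounded (KU _ Kx).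
  have r2 : 0 < r / 2 by lra.
  have r8 : 0 < r / 8 by lra.
  near=> y n => /=.
  have xy : disc x (r / 2) y by near: y; exact: near_disc.
  have nr : n.+1%:R^-1 < r / 8.
    by near: n; exact: (near_infty_natSinv_lt (PosNum r8)).
  have nB : B <= n%:R by near: n; exact: nbhs_infty_ger.
  have sub z : closed_disc y (4 * n.+1%:R^-1) z -> disc x r z.
    rewrite /closed_disc /disc /= => zy; move: xy; rewrite /disc /= => xy.
    move: nr zy; set q := _^-1 => nr zy.
    by have := normcB_triangle y z x; lra.
  split=> z /sub; first exact: rU.
  by move/fB/le_trans; apply; rewrite lee_fin.
have {}H1 := H1 n0 (leqnn _).
pose r : R := n0.+1%:R^-1.
have r0 : 0 < r by rewrite /r invr_gt0.
pose P2 (n : nat) x := exists2 z, normc (z - x) <= r & ((- n%:R)%:E <= f z)%E.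
have [n1 _ H2] : \forall n \near \oo, K `<=` P2 n.
  apply: ncK => x Kx.
  have r2 : 0 < r / 2 by lra.
  have [w xw fw] := subharmonic_finite_dense (KU _ Kx) r2.
  have [A fA] : exists A : R, ((- A)%:E <= f w)%E.
    case: (f w) fw => [u| |] // _; last by exists 0; rewrite leey.
    by exists (- u); rewrite opprK.
  near=> y n => /=.
  have xy : disc x (r / 2) y by near: y; exact: near_disc.
  have nA : A <= n%:R by near: n; exact: nbhs_infty_ger.
  exists w; last by apply: le_trans fA; rewrite lee_fin lerN2.
  move: xw xy; rewrite /disc /= => xw xy.
  by have := normcB_triangle x w y; rewrite (normc_distC x y); lra.
exists r, n1%:R, n0%:R; split => //.
- by move=> x /H1[].
- by move=> x z /H1[_]; apply.
- by move=> x /(H2 n1 (leqnn _)).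
Unshelve. all: by end_near. Qed.

End finiteness.

(** * Hausdorff measure *)

Section hausdorff_metric.
Context {R : realType}.
Variable d : R.
Implicit Types (A B T V : set R[i]) (z w : R[i]).
Local Open Scope ereal_scope.

Lemma le_hausdorff_content (delta1 delta2 : R) A : (delta1 <= delta2)%R ->
  hausdorff_content d delta2 A <= hausdorff_content d delta1 A.
Proof.
move=> d12; apply: le_ereal_inf_tmp => _ [F [dF AF] <-].
apply: ereal_inf_lbound; exists F => //; split=> // k.
by apply: le_trans (dF k) _; rewrite lee_fin.
Qed.

(** A covering set of diameter below e cannot meet both [A] and [B], so each cover of the union
    splits into a cover of [A] and one of [B]. *)
Lemma hausdorff_content_separated (delta e : R) A B : (delta < e)%R ->
  (forall z w, A z -> B w -> (e <= normc (z - w))%R) ->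
  hausdorff_content d delta A + hausdorff_content d delta B <=
  hausdorff_content d delta (A `|` B).
Proof.
move=> de sep; apply: le_ereal_inf_tmp => _ [F [dF AF] <-].
pose meets k := `[< F k `&` A !=set0 >].
pose FA k := if meets k then F k else set0.
pose FB k := if meets k then set0 else F k.
have hA : hausdorff_content d delta A <= \sum_(k <oo) diam_pow d (FA k).
  apply: ereal_inf_lbound; exists FA => //; split=> [k|z Az].
    by rewrite /FA; case: ifP => // _; rewrite diam_set0 leNye.
  have [k _ Fz] := AF z (or_introl Az).
  by exists k => //; rewrite /FA ifT//; apply/asboolP; exists z.
have hB : hausdorff_content d delta B <= \sum_(k <oo) diam_pow d (FB k).
  apply: ereal_inf_lbound; exists FB => //; split=> [k|w Bw].
    by rewrite /FB; case: ifP => // _; rewrite diam_set0 leNye.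
  have [k _ Fw] := AF w (or_intror Bw).
  exists k => //; rewrite /FB ifF//; apply/asboolP => -[z [Fz Az]].
  have : (normc (z - w))%:E <= delta%:E.
    by apply: le_trans (dF k); apply: ereal_sup_ubound; exists (z, w).
  by rewrite lee_fin leNgt (lt_le_trans de)//; exact: sep.
apply: le_trans (leeD hA hB) _; rewrite -nneseriesD; last 2 first.
- by move=> k _ _; exact: diam_pow_ge0.
- by move=> k _ _; exact: diam_pow_ge0.
apply: lee_nneseries => k _; first by rewrite adde_ge0 ?diam_pow_ge0.
by rewrite /FA /FB; case: ifP => _; rewrite diam_pow0 ?adde0 ?add0e.
Qed.

(** This is the metric outer measure property, from which measurability of open sets follows. *)
Lemma hausdorff_separated (e : R) A B : (0 < e)%R ->
  (forall z w, A z -> B w -> (e <= normc (z - w))%R) ->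
  hausdorff d A + hausdorff d B <= hausdorff d (A `|` B).
Proof.
move=> e0 sep; have [->|] := eqVneq (hausdorff d (A `|` B)) +oo.
  exact: leey.
rewrite -ltey => fin.
(* Independent [d1] and [d2] allow the two suprema to be taken one after the other; both contents
   only grow when passing to a common scale below e. *)
have key (d1 d2 : R) : (0 < d1)%R -> (0 < d2)%R ->
    hausdorff_content d d1 A + hausdorff_content d d2 B <= hausdorff d (A `|` B).
  move=> d10 d20; pose delta := Num.min (Num.min d1 d2) (e / 2)%R.
  have delta0 : (0 < delta)%R by rewrite !lt_min d10 d20 divr_gt0.
  apply: le_trans (hausdorff_content_le_sup d (A `|` B) delta0).
  apply: (le_trans _ (@hausdorff_content_separated delta e A B _ sep)).
    by apply: leeD; apply: le_hausdorff_content; rewrite /delta !ge_min lexx ?orbT.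
  by rewrite /delta gt_min; apply/orP; right; lra.
have finB : hausdorff d B \is a fin_num.
  rewrite ge0_fin_numE ?hausdorff_ge0//; apply: le_lt_trans fin.
  by apply: le_hausdorff; exact: subsetUr.
rewrite -leeBrDr//; apply: ge_ereal_sup => _ [d1 /= d10 <-].
have finA : hausdorff_content d d1 A \is a fin_num.
  rewrite ge0_fin_numE ?hausdorff_content_ge0//; apply: le_lt_trans fin.
  apply: le_trans (hausdorff_content_le_sup d A d10) _.
  by apply: le_hausdorff; exact: subsetUl.
rewrite leeBrDr// addeC -leeBrDr//; apply: ge_ereal_sup => _ [d2 /= d20 <-].
by rewrite leeBrDr// addeC; exact: key.
Qed.

Definition disc_interior V (n : nat) : set R[i] :=
  [set z | disc z n.+1%:R^-1 `<=` V].

Lemma disc_interiorS V m n : (m <= n)%N -> disc_interior V m `<=` disc_interior V n.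
Proof.
move=> mn z Vz w; rewrite /disc /= => wz; apply: Vz; rewrite /disc /=.
by apply: (lt_le_trans wz); rewrite lef_pV2 ?posrE// ler_nat ltnS.
Qed.

Lemma disc_interior_separated V m n z w : disc_interior V m z ->
  ~ disc_interior V n w -> (m.+1%:R^-1 - n.+1%:R^-1 <= normc (z - w))%R.
Proof.
move=> Vz Vw; rewrite leNgt; apply/negP => zw; apply: Vw => y.
rewrite /disc /= => yw; apply: Vz; rewrite /disc /=.
have := normcB_triangle w y z; rewrite (normc_distC w z).
by move: yw zw; set a := n.+1%:R^-1%R; set b := m.+1%:R^-1%R; lra.
Qed.

(* Continuity from below along the sets V_n of points at distance at least
   1/(n+1) from the complement of V: consecutive shells V_(n+1) \ V_n with
   indices of the same parity are at positive distance from each other. *)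
Lemma hausdorff_disc_interior T V (c : \bar R) : open V ->
  hausdorff d T < +oo ->
  (forall n, hausdorff d (T `&` disc_interior V n) <= c) ->
  hausdorff d (T `&` V) <= c.
Proof.
move=> oV Tfin hc; set H := hausdorff d in Tfin hc *.
pose D n := T `&` disc_interior V n.
pose S n := T `&` (disc_interior V n.+2 `\` disc_interior V n.+1).
have HD n : H (D n) <= H T by apply: le_hausdorff; exact: subIsetl.
(* [S n] starts one layer beyond [D n], so the two are separated and their union lies in [D n.+2].
   The two terms on the right take care of the two parities. *)
have partial n : \sum_(0 <= k < n) H (S k) <= H (D n) + H (D n.+1).
  elim: n => [|n ih].
    by rewrite big_geq// adde_ge0 ?hausdorff_ge0.
  rewrite big_nat_recr//=; apply: le_trans (leeD2r _ ih) _.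
  rewrite addeAC addeC; apply: leeD2l => //.
  have sub : D n `|` S n `<=` D n.+2.
    move=> z [[Tz Vz]|[Tz [Vz _]]]; split=> //.
    by apply: disc_interiorS Vz; rewrite -addn2 leq_addr.
  apply: le_trans (le_hausdorff d sub).
  apply: (@hausdorff_separated (n.+1%:R^-1 - n.+2%:R^-1)%R).
    by rewrite subr_gt0 ltf_pV2 ?posrE// ltr_nat.
  by move=> z w [_ Vz] [_ [_ Vw]]; exact: disc_interior_separated Vz Vw.
have S0 k : 0 <= H (S k) by exact: hausdorff_ge0.
have Sfin : \sum_(0 <= k <oo) H (S k) < +oo.
  apply: (@le_lt_trans _ _ (H T + H T)); last by rewrite lte_add_pinfty.
  apply: lime_le; first by apply: is_cvg_nneseries => k _ _; exact: S0.
  by apply: nearW => n; apply: le_trans (partial n) _; apply: leeD.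
apply/lee_addgt0Pr => e e0.
have tail := nneseries_tail_cvg Sfin (fun k _ => S0 k).
have [n tn] : exists n, \sum_(n <= k <oo) H (S k) < e%:E.
  have /fine_cvgP[tfin tlim] := tail.
  have tlt : \forall n \near \oo, (fine (\sum_(n <= k <oo) H (S k)) < e)%R.
    exact: (cvgr_lt _ tlim).
  have [n _ /(_ n (leqnn n)) /= [nfin nlt]] := filterI tfin tlt.
  by exists n; rewrite -(fineK nfin) lte_fin.
(* Points of T in V but outside [D n.+1] lie in a shell of index at least n, and these shells have
   total measure below e. *)
pose F k := if (n <= k)%N then S k else set0.
have cover : T `&` V `<=` D n.+1 `|` \bigcup_k F k.
  move=> z [Tz Vz]; have [N VN] : exists N, disc_interior V N z.
    have /nbhs_disc[r r0 rV] : nbhs z V by move: oV; rewrite openE; apply.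
    have [N _ /(_ N (leqnn N)) /= HN] := near_infty_natSinv_lt (PosNum r0).
    exists N => w; rewrite /disc /= => wz; apply: rV; exact: lt_trans wz HN.
  elim: N VN => [V0|N ih VN].
    by left; split=> //; apply: disc_interiorS V0.
  have [VN'|VN'] := pselect (disc_interior V N z); first exact: ih.
  have [Nn|nN] := leqP N.+1 n.+1.
    by left; split=> //; apply: disc_interiorS VN.
  right; case: N VN VN' nN {ih} => // N VN VN' nN.
  by exists N => //; rewrite /F -ltnS -ltnS nN.
apply: le_trans (le_hausdorff d cover) _.
apply: le_trans (outer_measureU2 (hausdorff_outer d) _ _) _.
apply: leeD; first exact: hc.
apply: le_trans (hausdorff_sigma_subadditive d F) _.
apply: le_trans (ltW tn).
rewrite (nneseries_split 0 n)//=; last by move=> k _; exact: hausdorff_ge0.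
rewrite add0n big_nat big1 ?add0e; last first.
  by move=> k /= kn; rewrite /F leqNgt kn /= hausdorff0.
apply: lee_nneseries => // k; rewrite ?/F; case: ifP => // _.
by rewrite hausdorff0.
Qed.

(** In Caratheodory's criterion, the part of T at distance at least 1/(n+1) from the complement of V
    is separated from T minus V. Continuity from below lets n tend to infinity. *)
Lemma measurable_open V : open V ->
  measurable (V : set (caratheodory_type (hausdorff_outer d))).
Proof.
move=> oV; apply: le_caratheodory_measurable => T /=.
have [->|] := eqVneq (hausdorff d T) +oo; first exact: leey.
rewrite -ltey => fin.
have finV : hausdorff d (T `&` ~` V) \is a fin_num.
  rewrite ge0_fin_numE ?hausdorff_ge0//; apply: le_lt_trans fin.
  by apply: le_hausdorff; exact: subIsetl.
rewrite -[leLHS]/(hausdorff d (T `&` V) + hausdorff d (T `&` ~` V)).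
rewrite -leeBrDr//; apply: hausdorff_disc_interior => // n.
rewrite leeBrDr//.
apply: (@le_trans _ _ (hausdorff d ((T `&` disc_interior V n) `|` (T `&` ~` V)))).
  apply: (@hausdorff_separated n.+1%:R^-1%R); first by rewrite invr_gt0.
  move=> z w [_ Vz] [_ Vw]; rewrite leNgt; apply/negP => zw; apply: Vw.
  by apply: Vz; rewrite /disc /= normc_distC.
by apply: le_hausdorff => z [[]|[]].
Qed.

End hausdorff_metric.

(** * Sublevel sets at small scales *)

Lemma powR_half_lt1 {R : realType} (d : R) : 0 < d -> 2^-1 `^ d < 1.
Proof.
move=> d0; have := @gt0_ltr_powR R d d0 2^-1 1.
rewrite powR1; apply; rewrite ?nnegrE//.
by rewrite invf_lt1//; lra.
Qed.

(** * Separated sets, packing and logarithmic sums *)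

Section separated_sets.
Context {R : realType}.
Implicit Types (K G A : set R[i]) (S L : seq R[i]) (z w x : R[i]).

Lemma compact_finite_cover K (r : R) : compact K -> 0 < r ->
  exists L : seq R[i], forall x, K x -> exists2 c, c \in L & disc c r x.
Proof.
rewrite compact_cover => cK r0.
have [D _ KD] := cK _ setT (fun c => disc c r) (fun c _ => @open_disc _ c r)
  (fun x _ => ex_intro2 _ _ x I (eq_ind_r (fun t => t < r) r0 (normcBxx x))).
by exists (finmap.enum_fset D) => x /KD[c /= cD xc]; exists c.
Qed.

Definition separated_seq (rho : R) S :=
  uniq S /\ forall w w', w \in S -> w' \in S -> w != w' -> rho <= normc (w - w').

(** Greedy choice along the finite list of centres: each disc of radius rho/2 contributes at most
    one new point of [G], and any other point in that disc is within rho of it. *)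
Lemma maximal_separated L G (rho : R) : 0 < rho -> exists S,
  [/\ separated_seq rho S, forall w, w \in S -> G w &
    forall g, G g -> (exists2 c, c \in L & disc c (rho / 2) g) ->
      exists2 w, w \in S & disc w rho g].
Proof.
move=> rho0; elim: L => [|c L [S [[uS sepS] SG Scov]]].
  by exists [::]; split => // g _ [].
have [[g [Gg cg gS]]|none] := pselect (exists g, [/\ G g, disc c (rho / 2) g &
    forall w, w \in S -> rho <= normc (g - w)]); last first.
  exists S; split => // g Gg [c']; rewrite in_cons => /orP[/eqP-> cg|cL cg].
    apply: contrapT => nS; apply: none; exists g; split=> // w wS.
    by rewrite leNgt; apply/negP => gw; apply: nS; exists w.
  by apply: Scov => //; exists c'.
exists (g :: S); split.
- split=> [|w w']; rewrite /= ?uS ?andbT ?in_cons.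
    by apply/negP => /gS; rewrite normcBxx leNgt rho0.
  move=> /orP[/eqP->|wS] /orP[/eqP->|w'S]; rewrite ?eqxx// => ww'.
  + exact: gS.
  + by rewrite normc_distC; exact: gS.
  + exact: sepS.
- by move=> w; rewrite in_cons => /orP[/eqP->//|/SG].
- move=> h Gh [c']; rewrite in_cons => /orP[/eqP-> ch|cL ch]; last first.
    have [w wS hw] := Scov h Gh (ex_intro2 _ _ c' cL ch).
    by exists w; rewrite // in_cons wS orbT.
  exists g; first by rewrite mem_head.
  move: cg ch; rewrite /disc /= => cg ch.
  by have := normcB_triangle c h g; rewrite (normc_distC c g); lra.
Qed.

Section packing.
Variables (d : R) (K : set R[i]).

(** The discs of radius rho/2 are disjoint. They are removed from [A] one at a time, each being
    Caratheodory measurable. *)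
Lemma packing S (rho m : R) A : 0 < rho -> separated_seq rho S ->
  (forall w, w \in S -> (m%:E <= hausdorff d (K `&` disc w (rho / 2)))%E) ->
  (forall w, w \in S -> disc w (rho / 2) `<=` A) ->
  (((size S)%:R * m)%:E <= hausdorff d (K `&` A))%E.
Proof.
move=> rho0; elim: S A => [|w S ih] A; first by move=> _ _ _; rewrite mul0r hausdorff_ge0.
move=> [/= /andP[wS uS] sep] hm hA.
have mw := measurable_open d (@open_disc R w (rho / 2)).
rewrite [leRHS](mw (K `&` A)) -natr1 mulrDl mul1r addrC EFinD.
apply: leeD.
  apply: le_trans (hm w (mem_head _ _)) _.
  apply: le_hausdorff => z [Kz wz]; split=> //; split=> //.
  by apply: (hA w) => //; rewrite mem_head.
rewrite -setIA; apply: ih.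
- by split=> // v v' vS v'S; apply: sep; rewrite in_cons ?vS ?v'S orbT.
- by move=> v vS; apply: hm; rewrite in_cons vS orbT.
- move=> v vS z vz; split; first by apply: (hA v) => //; rewrite in_cons vS orbT.
  move=> wz; have : rho <= normc (w - v).
    apply: sep; rewrite ?mem_head// ?in_cons ?vS ?orbT//.
    by apply: contraNneq wS => ->.
  move: vz wz; rewrite /disc /= => vz wz.
  by have := normcB_triangle z w v; rewrite (normc_distC w z); lra.
Qed.

Variables (a b D : R).
Hypotheses (b0 : 0 < b) (d0 : 0 < d)
  (low : forall x s, K x -> 0 < s -> s <= D ->
     ((b * s `^ d)%:E <= hausdorff d (K `&` disc x s))%E)
  (upp : forall x s, K x -> 0 < s -> s <= D ->
     (hausdorff d (K `&` disc x s) <= (a * s `^ d)%:E)%E).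

(** Since [z] need not lie in [K], the upper regularity is applied at a counted point [w0]: the
    rho/2-discs around all counted points lie in the disc of radius 3 sigma around it. The factor 6
    / rho is 3 divided by rho/2. *)
Lemma separated_count S (rho sigma : R) z : 0 < rho -> rho <= sigma ->
  3 * sigma <= D -> separated_seq rho S -> (forall w, w \in S -> K w) -> 0 <= a ->
  (count (fun w => normc (z - w) < sigma) S)%:R <=
    a / b * (6 / rho) `^ d * sigma `^ d.
Proof.
move=> rho0 rs sD sepS SK a0; have s0 := lt_le_trans rho0 rs.
rewrite -size_filter; set S' := seq.filter _ S.
have [e|] := eqVneq S' [::].
  by rewrite e /= !mulr_ge0 ?powR_ge0// invr_ge0 ltW.
case e : S' => [//|w0 S1] _; rewrite -e.
have w0S : w0 \in S' by rewrite e mem_head.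
have inS w : w \in S' -> normc (z - w) < sigma /\ w \in S.
  by rewrite mem_filter => /andP[].
have [zw0 w0S'] := inS _ w0S.
have sep' : separated_seq rho S'.
  case: sepS => uS sep; split; first exact: filter_uniq.
  by move=> v v' /inS[_ vS] /inS[_ v'S]; exact: sep.
have := @packing S' rho (b * (rho / 2) `^ d) (disc w0 (3 * sigma)) rho0 sep'.
move=> /(_ _ _)/le_trans/(_ (upp _ _ _)); rewrite lee_fin.
have r2 : 0 < (rho / 2) `^ d by rewrite powR_gt0// divr_gt0.
move=> H; rewrite -(ler_pM2r (mulr_gt0 b0 r2)).
apply: le_trans (H _ _ (SK _ w0S') _ sD) _; last 1 first.
- rewrite le_eqVlt; apply/orP; left; apply/eqP.
  have -> : 3 * sigma = (rho / 2) * (6 / rho * sigma) by field; rewrite lt0r_neq0.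
  have c0 : 0 <= rho / 2 by rewrite divr_ge0 ?(ltW rho0).
  have c1 : 0 <= 6 / rho by rewrite divr_ge0 ?(ltW rho0).
  rewrite (powRM _ c0 (mulr_ge0 c1 (ltW s0))) (powRM _ c1 (ltW s0)).
  move: (_ `^ d) (_ `^ d) (sigma `^ d) => u v w.
  by field; rewrite lt0r_neq0.
- move=> w /inS[_ wS]; apply: low; [exact: SK|by rewrite divr_gt0|lra].
- move=> w /inS[zw _] y; rewrite /disc /= => wy.
  have := normcB_triangle w y w0; have := normcB_triangle z w w0.
  by rewrite (normc_distC w z); lra.
- lra.
Qed.

(** Each halving of tau lowers the logarithm by ln 2, so counting the dyadic scales above r bounds
    it. *)
Lemma ln_le_dyadic n (tau r : R) : 0 < r -> 0 < tau -> tau * 2^-1 ^+ n <= r ->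
  ln (tau / r) <= ln 2 * \sum_(k < n) (r < tau * 2^-1 ^+ k)%R%:R.
Proof.
move=> r0; elim: n tau => [|n ih] tau t0.
  rewrite expr0 mulr1 => tr; rewrite big_ord0 mulr0 ln_le0//.
  by rewrite ler_pdivrMr// mul1r.
rewrite exprS mulrA => tr; rewrite big_ord_recl /= expr0 mulr1.
have ln20 : 0 <= ln 2 :> R by rewrite ln_ge0//; lra.
have [rt|rt] := ltP r tau; last first.
  apply: (@le_trans _ _ 0); first by rewrite ln_le0// ler_pdivrMr// mul1r.
  by rewrite mulr_ge0// addr_ge0// sumr_ge0.
have t20 : 0 < tau * 2^-1 by rewrite mulr_gt0.
rewrite mulrDr mulr1 (_ : tau / r = 2 * (tau * 2^-1 / r)); last first.
  by field; rewrite lt0r_neq0.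
rewrite lnM ?posrE ?divr_gt0// lerD2l (le_trans (ih _ t20 tr))// ler_wpM2l//.
by apply: ler_sum => k _; rewrite /bump /= add1n exprS mulrA.
Qed.

Lemma sum_geometric_le (q : R) n : 0 <= q -> q < 1 ->
  \sum_(k < n) q ^+ k <= (1 - q)^-1.
Proof.
move=> q0 q1; have q10 : 0 < 1 - q by rewrite subr_gt0.
rewrite -(ler_pM2l q10) divff ?lt0r_neq0//.
have -> : (1 - q) * \sum_(k < n) q ^+ k = 1 - q ^+ n.
  by rewrite -[1 - q]opprB mulNr -subrX1 opprB.
by rewrite gerBl exprn_ge0.
Qed.

(** The logarithms are split over dyadic scales and the sums exchanged. At scale sigma >= rho at
    most a multiple of sigma^d points count, and below rho none do; this leaves a geometric series
    of ratio 2^-d. *)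
Lemma sum_ln_le S (rho tau : R) z : 0 < rho -> 0 < tau ->
  3 * tau <= D -> separated_seq rho S -> (forall w, w \in S -> K w) -> 0 <= a ->
  (forall w, w \in S -> rho <= normc (z - w)) ->
  \sum_(w <- S) ln (tau / normc (z - w)) <=
    ln 2 / (1 - 2^-1 `^ d) * (a / b) * (6 * tau / rho) `^ d.
Proof.
move=> rho0 tau0 tD sepS SK a0 zS.
have [n ntau] : exists n, tau * 2^-1 ^+ n <= rho.
  have [n _ /(_ n (leqnn n)) /=] :=
    near_infty_natSinv_expn_lt (PosNum (divr_gt0 rho0 tau0)).
  rewrite ltr_pdivlMr// => /ltW h; exists n; apply: le_trans h.
  by rewrite mul1r exprVn mulrC.
pose q : R := 2^-1 `^ d.
have q0 : 0 <= q by exact: powR_ge0.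
have q1 : q < 1 by exact: powR_half_lt1.
have ln20 : 0 <= ln 2 :> R by rewrite ln_ge0//; lra.
have C0 : 0 <= a / b * (6 / rho) `^ d by rewrite mulr_ge0 ?powR_ge0// divr_ge0// ltW.
apply: (@le_trans _ _ (\sum_(w <- S)
  ln 2 * \sum_(k < n) (normc (z - w) < tau * 2^-1 ^+ k)%R%:R)).
  rewrite big_seq [leRHS]big_seq; apply: ler_sum => w wS.
  apply: ln_le_dyadic => //; first exact: lt_le_trans rho0 (zS w wS).
  exact: le_trans ntau (zS w wS).
rewrite -big_distrr /= exchange_big /=.
apply: (@le_trans _ _ (ln 2 * \sum_(k < n)
  (a / b * (6 / rho) `^ d * (tau * 2^-1 ^+ k) `^ d))).
  apply: ler_wpM2l => //; apply: ler_sum => k _.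
  set sigma := tau * _.
  have -> : \sum_(w <- S) (normc (z - w) < sigma)%R%:R =
      (count (fun w => normc (z - w) < sigma) S)%:R :> R.
    rewrite -natr_sum; congr (_%:R); elim: (S) => [|w T ih]; first by rewrite big_nil.
    by rewrite big_cons ih.
  have s0 : 0 < sigma by rewrite mulr_gt0// exprn_gt0.
  have st : sigma <= tau.
    by rewrite /sigma ler_piMr ?(ltW tau0)// exprn_ile1// invf_le1//; lra.
  have [rs|sr] := leP rho sigma; first by apply: separated_count => //; lra.
  rewrite (_ : count _ _ = 0%N); first by rewrite mulr_ge0 ?powR_ge0.
  apply/eqP; rewrite -leqn0 leqNgt -has_count; apply/hasPn => w wS.
  by rewrite -leNgt (le_trans (ltW sr))// zS.
rewrite -big_distrr /=.
have -> : \sum_(k < n) (tau * 2^-1 ^+ k) `^ d = tau `^ d * \sum_(k < n) q ^+ k.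
  rewrite big_distrr /=; apply: eq_bigr => k _.
  rewrite powRM ?exprn_ge0 ?(ltW tau0)//; congr (_ * _).
  elim: (nat_of_ord k) => [|m ihm]; first by rewrite !expr0 powR1.
  by rewrite !exprS powRM ?exprn_ge0// ihm.
rewrite (_ : 6 * tau / rho = 6 / rho * tau); last by rewrite mulrAC.
have c0 : 0 <= 6 / rho by rewrite divr_ge0 ?(ltW rho0).
rewrite (powRM _ c0 (ltW tau0)).
have := sum_geometric_le n q0 q1; set s := \sum_(k < n) _ => sle.
rewrite -/q.
have P0 : 0 <= ln 2 * (a / b * (6 / rho) `^ d * tau `^ d).
  by rewrite !mulr_ge0 ?powR_ge0// invr_ge0 ltW.
have -> : ln 2 * (a / b * (6 / rho) `^ d * (tau `^ d * s)) =
    ln 2 * (a / b * (6 / rho) `^ d * tau `^ d) * s by ring.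
apply: le_trans (ler_wpM2l P0 sle) _.
by rewrite le_eqVlt; apply/orP; left; apply/eqP; rewrite /q; ring.
Qed.

End packing.
End separated_sets.

(** * The measure of a deep sublevel set *)

Section small_scale.
Context {R : realType}.
Variables (U : set R[i]) (f : R[i] -> \bar R).
Hypotheses (oU : open U) (hf : subharmonic U f).
Variables (d : R) (K : set R[i]) (a b D : R).
Hypotheses (cK : compact K) (a0 : 0 < a) (b0 : 0 < b) (d0 : 0 < d)
  (low : forall x s, K x -> 0 < s -> s <= D ->
     ((b * s `^ d)%:E <= hausdorff d (K `&` disc x s))%E)
  (upp : forall x s, K x -> 0 < s -> s <= D ->
     (hausdorff d (K `&` disc x s) <= (a * s `^ d)%:E)%E).
Implicit Types (z w x : R[i]) (S : seq R[i]).

Lemma hausdorff_cover_le S (rho m : R) (G : set R[i]) : G `<=` K ->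
  (forall w, w \in S -> (hausdorff d (K `&` disc w rho) <= m%:E)%E) ->
  (forall g, G g -> exists2 w, w \in S & disc w rho g) ->
  (hausdorff d G <= ((size S)%:R * m)%:E)%E.
Proof.
elim: S G => [|w S ih] G GK hm cov.
  rewrite (_ : G = set0) ?hausdorff0 ?mul0r//.
  by rewrite -subset0 => g /cov[].
rewrite -(setUIDK G (disc w rho)).
apply: le_trans (outer_measureU2 (hausdorff_outer d) _ _) _.
rewrite /= -natr1 mulrDl mul1r addrC EFinD; apply: leeD; last first.
  apply: le_trans (hm w (mem_head _ _)).
  by apply: le_hausdorff => g [/GK Kg wg].
apply: ih => [g [/GK]//|v vS|g [Gg wg]]; first by apply: hm; rewrite in_cons vS orbT.
have [v + vg] := cov g Gg; rewrite in_cons => /orP[/eqP ve|vS].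
  by case: wg; rewrite -ve.
by exists v.
Qed.

Lemma ln_ratio_sum S (tau : R) z : 0 < tau -> (forall w, w \in S -> z != w) ->
  \sum_(w <- S) ln (normc (z - w)) =
  (size S)%:R * ln tau - \sum_(w <- S) ln (tau / normc (z - w)).
Proof.
move=> tau0; elim: S => [|w S ih] zS; first by rewrite !big_nil mul0r subr0.
rewrite !big_cons ih; last by move=> v vS; apply: zS; rewrite in_cons vS orbT.
have zw : 0 < normc (z - w) by rewrite normc_gt0// subr_eq0 zS// mem_head.
by rewrite ln_div ?posrE//= -natr1; ring.
Qed.

Lemma size_mul_le_sum S (F : R[i] -> R) (m : R) :
  (forall w, w \in S -> m <= F w) -> (size S)%:R * m <= \sum_(w <- S) F w.
Proof.
elim: S => [|w S ih] mF; first by rewrite big_nil mul0r.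
rewrite big_cons /= -natr1 mulrDl mul1r addrC lerD ?mF ?mem_head//.
by apply: ih => v vS; apply: mF; rewrite in_cons vS orbT.
Qed.

(** The bound of [sum_ln_le] at tau = 3t without its factor (t / rho)^d; 18 is 6 times 3. *)
Definition log_constant : R := ln 2 / (1 - 2^-1 `^ d) * (a / b) * 18 `^ d.

Lemma log_constant_gt0 : 0 < log_constant.
Proof.
have ln20 : 0 < ln 2 :> R by rewrite ln_gt0//; lra.
have q1 := powR_half_lt1 d0.
by rewrite /log_constant !mulr_gt0 ?invr_gt0 ?subr_gt0// powR_gt0.
Qed.

(** The comparison function is s + c1 - c sum ln (3t / |z - w|). Evaluated at [z0] it bounds the
    size of [S], hence the measure of the rho-discs covering the sublevel set; rho cancels. The
    condition 9 t <= D serves [sum_ln_le] at tau = 3t. *)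
Lemma sublevel_content x z0 (t s c1 N : R) : K x -> 0 < t -> 9 * t <= D ->
  0 <= c1 -> closed_disc x (4 * t) `<=` U ->
  (forall z, closed_disc x (4 * t) z -> (f z <= (s + c1)%:E)%E) ->
  closed_disc x t z0 -> ((s - 1)%:E <= f z0)%E -> 1 <= N ->
  a * ((1 + c1) * log_constant / ((N + c1) * ln (3 / 2))) <= b / 2 ->
  (hausdorff d ((K `&` disc x t) `&` [set z | U z /\ (f z < (s - N)%:E)%E])
    <= (b / 2 * t `^ d)%:E)%E.
Proof.
move=> Kx t0 tD c10 xU fs z0t fz0 N1 hN.
set V := [set z | U z /\ _].
have oV : open V by exact: open_sublevel.
apply: hausdorff_disc_interior => //.
  by apply: le_lt_trans (upp Kx t0 _) _; [lra|rewrite ltry].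
(* Since [V] is approximated from inside, the discs of radius 2 rho around the points of [S] lie in
   [V]. *)
move=> n; pose rho := Num.min (n.+1%:R^-1 / 2) t.
have rho0 : 0 < rho by rewrite lt_min t0 divr_gt0.
have rhot : rho <= t by rewrite /rho ge_min lexx orbT.
have rhon : 2 * rho <= n.+1%:R^-1.
  have : rho <= n.+1%:R^-1 / 2 by rewrite /rho ge_min lexx.
  by set q := n.+1%:R^-1; lra.
set G := _ `&` disc_interior V n.
have [L KL] := compact_finite_cover cK (divr_gt0 rho0 (ltr0n R 2)).
have [S [sepS SG Scov]] := maximal_separated L G rho0.
have SK w : w \in S -> K w by move=> /SG[[]].
have Sx w : w \in S -> normc (w - x) < t by move=> /SG[[_]].
have SV w z : w \in S -> normc (z - w) < 2 * rho -> V z.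
  by move=> /SG[_ wV] zw; apply: wV; exact: lt_le_trans rhon.
pose Q := ln 2 / (1 - 2^-1 `^ d) * (a / b) * (6 * (3 * t) / rho) `^ d.
have sumQ z : (forall w, w \in S -> rho <= normc (z - w)) ->
    \sum_(w <- S) ln (3 * t / normc (z - w)) <= Q.
  move=> zS; apply: (@sum_ln_le _ d K a b D b0 d0 low upp) => //.
  - by rewrite mulr_gt0.
  - by lra.
  - exact: ltW.
have QE : Q * rho `^ d = log_constant * t `^ d.
  rewrite /Q /log_constant (_ : 6 * (3 * t) / rho = 18 * (t / rho)); last first.
    by field; rewrite lt0r_neq0.
  have tr0 : 0 <= t / rho by rewrite divr_ge0 ?ltW.
  have e : (18 * (t / rho)) `^ d * rho `^ d = 18 `^ d * t `^ d.
    rewrite powRM// -mulrA -(powRM _ tr0 (ltW rho0)) divfK ?lt0r_neq0//.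
  by rewrite -mulrA e mulrA.
have Q0 : 0 < Q.
  rewrite -(pmulr_lgt0 _ (powR_gt0 d rho0)) QE mulr_gt0 ?powR_gt0//.
  exact: log_constant_gt0.
have Nc : 0 < N + c1 by lra.
have ln32 : 0 < ln (3 / 2) :> R by rewrite ln_gt0//; lra.
(* The largest slope for which a potential of at most Q keeps the majorant at or above s - N. *)
pose c := (N + c1) / Q; have c0 : 0 < c by rewrite divr_gt0.
have cQ : c * Q = N + c1 by rewrite /c divfK ?lt0r_neq0.
pose k := s + c1 - c * ((size S)%:R * ln (3 * t)).
have t3 : 0 < 3 * t by rewrite mulr_gt0.
pose h z := k + c * \sum_(w <- S) ln (normc (z - w)).
pose Z := closed_disc x (4 * t) `&`
  \bigcap_(w in [set` S]) [set z | rho <= normc (z - w)].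
have ZS z w : Z z -> w \in S -> z != w.
  move=> [_ Zz] wS; apply: contraTneq (Zz w wS) => ->.
  by rewrite /= normcBxx -ltNge.
have hE z : Z z -> h z = s + c1 - c * \sum_(w <- S) ln (3 * t / normc (z - w)).
  move=> Zz; rewrite /h (ln_ratio_sum t3 (fun w => ZS z w Zz)) /k; ring.
have ZQ z : Z z -> \sum_(w <- S) ln (3 * t / normc (z - w)) <= Q.
  by move=> [_ Zz]; exact: sumQ.
have lowV z w : Z z -> w \in S -> normc (z - w) < 2 * rho -> (f z <= (h z)%:E)%E.
  move=> Zz wS zw; have [_ fz] := SV w z wS zw.
  apply: le_trans (ltW fz) _; rewrite lee_fin hE//.
  by have := ler_wpM2l (ltW c0) (ZQ z Zz); lra.
have fh z : Z z -> (f z <= (h z)%:E)%E.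
  apply: (@max_principle_log _ U f hf S k c Z x (4 * t)) => //.
  - exact: ltW.
  - apply: closedI; first exact: closed_closed_disc.
    by apply: closed_bigI => w _; exact: closed_ge_normc.
  - by move=> y [].
  - by move=> y [/xU].
  - move=> y Zy; have [yx yS] := Zy.
    have [[w wS yw]|far] := pselect (exists2 w, w \in S & normc (y - w) < 2 * rho).
      by left; exact: (lowV y w).
    (* On the outer circle every |y - w| exceeds 3t, so the potential is nonpositive and the
       majorant is at least s + c1. *)
    have [y4|y4] := leP (4 * t) (normc (y - x)).
      left; apply: le_trans (fs y yx) _; rewrite -[leRHS]/((h y)%:E) lee_fin hE//.
      rewrite lerDl oppr_ge0 mulr_ge0_le0 ?(ltW c0)//.
      rewrite big_seq; apply: sumr_le0 => w wS; rewrite ln_le0//.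
      have := Sx w wS; have := normcB_triangle w y x => ? ?.
      have yw0 : 0 < normc (y - w) by lra.
      by rewrite ler_pdivrMr// mul1r; lra.
    right; exists (Num.min rho (4 * t - normc (y - x))).
      by rewrite lt_min rho0 subr_gt0.
    move=> v; rewrite /closed_disc /= le_min => /andP[zr z4]; split.
      by rewrite /closed_disc /=; have := normcB_triangle y v x; lra.
    move=> w /= wS; have : 2 * rho <= normc (y - w).
      by rewrite leNgt; apply/negP => yw; apply: far; exists w.
    by have := normcB_triangle v y w; rewrite (normc_distC y v); lra.
have z0S w : w \in S -> rho <= normc (z0 - w).
  move=> wS; rewrite leNgt; apply/negP => zw.
  have [_] : V z0 by apply: (SV w) => //; apply: (lt_trans zw); lra.
  by rewrite ltNge => /negP; apply; apply: le_trans fz0; rewrite lee_fin; lra.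
have Zz0 : Z z0.
  split; last by move=> w /z0S.
  by move: z0t; rewrite /closed_disc /= => /le_trans; apply; lra.
have := le_trans fz0 (fh z0 Zz0); rewrite lee_fin hE// => le1.
(* Both [z0] and the points of [S] are within t of x, so their distances are at most 2t. *)
have le2 : (size S)%:R * ln (3 / 2) <= \sum_(w <- S) ln (3 * t / normc (z0 - w)).
  apply: size_mul_le_sum => w wS.
  have zw0 := lt_le_trans rho0 (z0S w wS).
  rewrite ler_ln ?posrE ?divr_gt0//.
  have := Sx w wS; have := normcB_triangle x z0 w; rewrite (normc_distC x w).
  by move: z0t; rewrite /closed_disc /= => ? ? ?; rewrite ler_pdivlMr//; lra.
have le3 : c * ((size S)%:R * ln (3 / 2)) <= 1 + c1.
  by have := ler_wpM2l (ltW c0) le2; lra.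
have le4 : (size S)%:R <= (1 + c1) / (c * ln (3 / 2)).
  rewrite ler_pdivlMr; first by rewrite mulrCA.
  exact: mulr_gt0.
have := @hausdorff_cover_le S rho (a * rho `^ d) G.
move=> /(_ _ _ _)/le_trans; apply.
- by move=> g [[]].
- by move=> w wS; apply: upp => //; [exact: SK|lra].
- move=> g Gg; apply: Scov => //.
  by have [[Kg _] _] := Gg; exact: KL.
rewrite lee_fin.
apply: (@le_trans _ _ ((1 + c1) / (c * ln (3 / 2)) * (a * rho `^ d))).
  by rewrite ler_wpM2r// mulr_ge0 ?powR_ge0// ltW.
have -> : (1 + c1) / (c * ln (3 / 2)) * (a * rho `^ d) =
    a * ((1 + c1) * (Q * rho `^ d) / ((N + c1) * ln (3 / 2))).
  by rewrite /c; field; rewrite !lt0r_neq0.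
rewrite QE.
have -> : a * ((1 + c1) * (log_constant * t `^ d) / ((N + c1) * ln (3 / 2))) =
   a * ((1 + c1) * log_constant / ((N + c1) * ln (3 / 2))) * t `^ d by ring.
by rewrite ler_wpM2r// powR_ge0.
Qed.

End small_scale.

(** * Averages *)

Section power_means.
Context {R : realType}.
Variable d : R.
Implicit Types (A F : set R[i]) (f g : R[i] -> \bar R).
Local Open Scope ereal_scope.

Lemma haverage_ge0 A g : (forall z, 0 <= g z) -> 0 <= haverage d A g.
Proof.
move=> g0; apply: mule_ge0; last by apply: integral_ge0 => z _; exact: g0.
by rewrite inve_ge0; exact: hausdorff_ge0.
Qed.

Lemma haverage_le A g (m c : R) :
  measurable (A : set (caratheodory_type (hausdorff_outer d))) ->
  hausdorff d A = m%:E -> (0 < m)%R -> (forall z, A z -> g z <= c%:E) ->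
  haverage d A g <= c%:E.
Proof.
move=> mA Am m0 gc; rewrite /haverage.
rewrite (_ : hausdorff_measure d A = m%:E)// inver ifF; last by rewrite gt_eqF.
have -> : c%:E = (m^-1)%:E * (c%:E * m%:E).
  by rewrite -!EFinM mulrCA mulVf ?mulr1// lt0r_neq0.
apply: lee_wpmul2l; first by rewrite lee_fin invr_ge0 ltW.
apply: le_trans (le_integral_nonmeasurable _ (g := cst c%:E) _) _ => //.
by rewrite integral_cst// -Am.
Qed.

Lemma haverage_ge A F g (m m' c : R) :
  measurable (F : set (caratheodory_type (hausdorff_outer d))) -> F `<=` A ->
  hausdorff d A = m%:E -> (0 < m)%R -> m'%:E <= hausdorff d F -> (0 <= c)%R ->
  (forall z, 0 <= g z) -> (forall z, F z -> c%:E <= g z) ->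
  (m' / m * c)%:E <= haverage d A g.
Proof.
move=> mF FA Am m0 Fm c0 g0 gc; rewrite /haverage.
rewrite (_ : hausdorff_measure d A = m%:E)// inver ifF; last by rewrite gt_eqF.
have -> : (m' / m * c)%:E = (m^-1)%:E * (c%:E * m'%:E).
  by rewrite -!EFinM; congr (_%:E); ring.
apply: lee_wpmul2l; first by rewrite lee_fin invr_ge0 ltW.
apply: (@le_trans _ _ (\int[hausdorff_measure d]_(z in F) cst c%:E z)).
  by rewrite integral_cst//; apply: lee_wpmul2l.
apply: (@le_trans _ _ (\int[hausdorff_measure d]_(z in F) g z)).
  exact: le_integral_nonmeasurable.
rewrite integral_mkcond [leRHS]integral_mkcond.
apply: le_integral_nonmeasurable => z _; rewrite !patchE.
case: ifPn => [|_]; first by rewrite inE => /FA Az; rewrite mem_set.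
by case: ifP.
Qed.

Lemma exp_mean_le A f (m sigma : R) (p : \bar R) :
  measurable (A : set (caratheodory_type (hausdorff_outer d))) ->
  hausdorff d A = m%:E -> (0 < m)%R -> (forall z, A z -> f z <= sigma%:E) ->
  1 <= p -> exp_mean d p A f <= (expR sigma)%:E.
Proof.
move=> mA Am m0 fs; case: p => [r| |] // p1; last first.
  apply: ge_ereal_sup => _ [z Az <-].
  by rewrite -[leRHS]/(expeR sigma%:E) lee_expeR fs.
have r0 : (0 < r)%R by move: p1; rewrite lee_fin; exact: lt_le_trans.
have -> : (expR sigma)%:E = (expR (r * sigma))%:E `^ r^-1.
  by rewrite poweR_EFin -expRM mulrAC divff ?mul1r// gt_eqF.
rewrite /exp_mean; apply: gt0_ler_poweR.
- by rewrite invr_ge0 ltW.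
- rewrite in_itv/= leey andbT; apply: haverage_ge0 => z; exact: expeR_ge0.
- by rewrite in_itv/= leey andbT lee_fin expR_ge0.
- apply: haverage_le Am m0 _ => // z Az.
  rewrite -[leRHS]/(expeR (r * sigma)%:E) lee_expeR EFinM.
  by apply: lee_wpmul2l; [rewrite lee_fin ltW|exact: fs].
Qed.

(** The power mean is at most e^sigma, while the average of e^f is at least (m' / m) e^sigma' from
    [F] alone. *)
Lemma exp_mean_reverse A F f (m m' sigma sigma' : R) (p : \bar R) :
  measurable (A : set (caratheodory_type (hausdorff_outer d))) ->
  measurable (F : set (caratheodory_type (hausdorff_outer d))) -> F `<=` A ->
  hausdorff d A = m%:E -> (0 < m)%R -> (0 < m')%R -> m'%:E <= hausdorff d F ->
  (forall z, A z -> f z <= sigma%:E) -> (forall z, F z -> sigma'%:E <= f z) ->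
  1 <= p ->
  exp_mean d p A f <=
    (m / m' * expR (sigma - sigma'))%:E * haverage d A (fun z => expeR (f z)).
Proof.
move=> mA mF FA Am m0 m'0 Fm fA fF p1.
apply: le_trans (exp_mean_le mA Am m0 fA p1) _.
have := @haverage_ge A F (fun z => expeR (f z)) m m' (expR sigma') mF FA Am m0 Fm.
move=> /(_ (expR_ge0 _) (fun z => expeR_ge0 _)) H.
apply: le_trans (lee_wpmul2l _ (H _)); last 2 first.
- by rewrite lee_fin mulr_ge0 ?expR_ge0// divr_ge0// ltW.
- by move=> z Fz; rewrite -[leLHS]/(expeR sigma'%:E) lee_expeR; exact: fF.
rewrite -EFinM lee_fin le_eqVlt; apply/orP; left; apply/eqP.
have -> : (expR sigma = expR (sigma - sigma') * expR sigma')%R.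
  by rewrite -expRD subrK.
move: (expR (sigma - _)) (expR sigma') => u v; field.
by rewrite !lt0r_neq0.
Qed.

End power_means.

(** * Uniform constants and the two ranges of radii *)

Section assembly.
Context {R : realType}.
Variables (U : set R[i]) (f : R[i] -> \bar R).
Hypotheses (oU : open U) (hf : subharmonic U f).
Variables (d : R) (K : set R[i]) (a b D : R).
Hypotheses (cK : compact K) (a0 : 0 < a) (b0 : 0 < b) (d0 : 0 < d) (D0 : 0 < D)
  (low : forall x s, K x -> 0 < s -> s <= D ->
     ((b * s `^ d)%:E <= hausdorff d (K `&` disc x s))%E)
  (upp : forall x s, K x -> 0 < s -> s <= D ->
     (hausdorff d (K `&` disc x s) <= (a * s `^ d)%:E)%E).
Implicit Types (z w x : R[i]).
Local Notation hmeasurable A :=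
  (measurable (A : set (caratheodory_type (hausdorff_outer d)))).

Lemma hausdorff_compact_lty : (hausdorff d K < +oo)%E.
Proof.
have [L KL] := compact_finite_cover cK (divr_gt0 D0 (ltr0n R 2)).
have [S [_ SK Scov]] := maximal_separated L K D0.
apply: le_lt_trans (@hausdorff_cover_le R d K S D (a * D `^ d) K _ _ _) (ltry _).
- by [].
- by move=> w /SK Kw; exact: upp.
- by move=> g Kg; apply: Scov => //; exact: KL.
Qed.

Lemma measurable_ball x (t : R) : hmeasurable (K `&` disc x t).
Proof.
apply: measurableI; last exact: (measurable_open d (@open_disc _ x t)).
have cl : closed K by apply: compact_closed cK; exact: norm_hausdorff.
rewrite -[K]setCK; apply: measurableC; apply: (@measurable_open _ d).
exact: closed_openC.
Qed.

(** Removing the sublevel set costs at most half of the lower bound b t^d. The final clause controls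
    how far s can fall below B; it is needed for large radii. *)
Lemma superlevel_half x (t r A B N : R) : K x -> 0 < t -> t <= r -> 9 * t <= D ->
  0 <= A + B -> closed_disc x (4 * r) `<=` U ->
  (forall z, closed_disc x (4 * r) z -> (f z <= B%:E)%E) ->
  (exists2 z, normc (z - x) <= r & ((- A)%:E <= f z)%E) ->
  1 <= N ->
  a * ((1 + (A + B)) * log_constant d a b / ((N + (A + B)) * ln (3 / 2))) <= b / 2 ->
  exists (s : R) (F : set R[i]), [/\ hmeasurable F, F `<=` K `&` disc x t,
    ((b / 2 * t `^ d)%:E <= hausdorff d F)%E,
    (forall z, closed_disc x t z -> (f z <= s%:E)%E) /\
    (forall z, F z -> ((s - N)%:E <= f z)%E) &
    B - s <= (A + B) * (ln (4 * r / t) / ln 4)].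
Proof.
move=> Kx t0 tr tD AB xU fB [z1 z1r fz1] N1 hN.
have r0 := lt_le_trans t0 tr.
have tB z : closed_disc x t z -> closed_disc x (4 * r) z.
  by rewrite /closed_disc /= => zt; lra.
pose sup := ereal_sup (f @` closed_disc x t).
have supB : (sup <= B%:E)%E.
  by apply: ge_ereal_sup => _ [z zt <-]; apply: fB; exact: tB.
have xx : closed_disc x t x by rewrite /closed_disc /= normcBxx ltW.
(* A value other than -oo makes the supremum a real number. *)
have [w xw fw] := @subharmonic_finite_dense _ U f oU hf x t (xU _ (tB _ xx)) t0.
have supfin : sup \is a fin_num.
  rewrite fin_real// (le_lt_trans supB) ?ltry// andbT.
  apply: (@lt_le_trans _ _ (f w)); first by rewrite ltNye; apply/eqP.
  by apply: ereal_sup_ubound; exists w => //; exact: ltW.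
pose s := fine sup; have sE : sup = s%:E by rewrite fineK.
have fs z : closed_disc x t z -> (f z <= s%:E)%E.
  by move=> zt; rewrite -sE; apply: ereal_sup_ubound; exists z.
have [_ [z0 z0t <-] fz0] := ub_ereal_sup_adherent ltr01 supfin.
pose V := [set z | U z /\ (f z < (s - N)%:E)%E].
have mV : hmeasurable V := measurable_open d (open_sublevel oU hf (c := s - N)).
have xU4 : closed_disc x (4 * t) `<=` closed_disc x (4 * r).
  by move=> z; rewrite /closed_disc /= => zt; lra.
exists s, ((K `&` disc x t) `&` ~` V); split.
- by apply: measurableI; [exact: measurable_ball|exact: measurableC].
- by move=> z [].
- have : ((b * t `^ d)%:E <= hausdorff d (K `&` disc x t))%E by apply: low => //; lra.
  rewrite (mV (K `&` disc x t)) => le1.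
  have le2 : (hausdorff d ((K `&` disc x t) `&` V) <= (b / 2 * t `^ d)%:E)%E.
    apply: (sublevel_content oU hf cK a0 b0 d0 low upp (z0 := z0) (c1 := A + B)) => //.
    + by move=> z /xU4/xU.
    + by move=> z; apply: (doubling hf t0 tr xU fB z1r fz1 fs).
    + by apply: ltW; move: fz0; rewrite -/sup sE -EFinB.
  have := le_trans le1 (leeD2r _ le2); rewrite -leeBlDl//.
  by rewrite -EFinB -mulrBl (_ : b - b / 2 = b / 2)//; lra.
- split=> // z [[Kz xz] nV]; rewrite leNgt; apply/negP => fz; apply: nV; split=> //.
  by apply/xU/tB; exact: ltW.
- exact: (doubling_lower hf t0 tr xU fB z1r fz1 fs).
Qed.

Lemma exp_mean_comparison : K `<=` U -> exists C : R, forall x (t : R) (p : \bar R),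
  K x -> 0 < t -> (1 <= p)%E ->
  (exp_mean d p (disc x t `&` K) f <=
   C%:E * haverage d (disc x t `&` K) (fun z => expeR (f z)))%E.
Proof.
move=> KU; have [/set0P[y Ky]|/negPn/eqP K0] := boolP (K != set0); last first.
  by exists 0 => x t p; rewrite K0.
have [r [A [B [r0 rU rB rA]]]] := subharmonic_uniform oU hf cK KU.
have AB : 0 <= A + B.
  have [z zr fz] := rA y Ky.
  have := le_trans fz (rB y z Ky _); rewrite /closed_disc /= lee_fin => h.
  have : - A <= B by apply: h; apply: (le_trans zr); lra.
  lra.
have ln32 : 0 < ln (3 / 2) :> R by rewrite ln_gt0//; lra.
have E0 : 0 < log_constant d a b by exact: log_constant_gt0.
pose X := a * ((1 + (A + B)) * log_constant d a b) / ln (3 / 2).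
have X0 : 0 <= X.
  apply: divr_ge0; last exact: ltW.
  apply: mulr_ge0; first exact: ltW.
  by apply: mulr_ge0; [lra|exact: ltW].
(* Chosen so that X / (N + A + B) <= b / 2. *)
pose N := 1 + 2 * X / b.
have N1 : 1 <= N.
  by rewrite lerDl; apply: divr_ge0; [exact: mulr_ge0|exact: ltW].
have hN :
    a * ((1 + (A + B)) * log_constant d a b / ((N + (A + B)) * ln (3 / 2))) <= b / 2.
  have NAB : 0 < N + (A + B) by lra.
  have -> : a * ((1 + (A + B)) * log_constant d a b / ((N + (A + B)) * ln (3 / 2))) =
      X / (N + (A + B)).
    by rewrite /X; field; rewrite !lt0r_neq0.
  rewrite ler_pdivrMr//.
  have : b / 2 * (2 * X / b) = X by field; rewrite lt0r_neq0.
  have : b / 2 * (2 * X / b) <= b / 2 * (N + (A + B)).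
    by rewrite ler_pM2l ?divr_gt0// /N; lra.
  lra.
pose T := Num.min r (D / 9).
have T0 : 0 < T by rewrite lt_min r0 divr_gt0.
have Tr : T <= r by rewrite /T ge_min lexx.
have TD : 9 * T <= D.
  have : T <= D / 9 by rewrite /T ge_min lexx orbT.
  lra.
have half x t (Kx : K x) (t0 : 0 < t) (tT : t <= T) (tD : 9 * t <= D) :=
  @superlevel_half x t r A B N Kx t0 (le_trans tT Tr) tD AB (rU x Kx)
    (fun z => rB x z Kx) (rA x Kx) N1 hN.
pose M := fine (hausdorff d K).
have ME : hausdorff d K = M%:E.
  by rewrite fineK// ge0_fin_numE ?hausdorff_ge0// hausdorff_compact_lty.
pose m1 := b / 2 * T `^ d.
have m10 : 0 < m1 by rewrite mulr_gt0 ?divr_gt0// powR_gt0.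
have M0 : 0 <= M by rewrite fine_ge0// hausdorff_ge0.
pose L := (A + B) * (ln (4 * r / T) / ln 4).
pose C1 := 2 * a / b * expR N.
pose C2 := M / m1 * expR (L + N).
exists (Num.max C1 C2) => x t p Kx t0 p1.
have avg0 : (0 <= haverage d (disc x t `&` K) (fun z => expeR (f z)))%E.
  by apply: haverage_ge0 => z; exact: expeR_ge0.
rewrite setIC in avg0 *; set Q := K `&` disc x t in avg0 *.
have QM : (hausdorff d Q <= M%:E)%E.
  by rewrite -ME; apply: le_hausdorff; exact: subIsetl.
pose m := fine (hausdorff d Q).
have mE : hausdorff d Q = m%:E.
  by rewrite fineK// ge0_fin_numE ?hausdorff_ge0// (le_lt_trans QM) ?ltry.
have tTpow : 0 < t `^ d by rewrite powR_gt0.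
have [tT|Tt] := leP t T.
  have tD : 9 * t <= D by lra.
  have [s [F [mF FQ hF [fs fF] _]]] := half x t Kx t0 tT tD.
  have m'0 : 0 < b / 2 * t `^ d by rewrite mulr_gt0 ?divr_gt0.
  have m0 : 0 < m.
    rewrite -lte_fin -mE; apply: lt_le_trans (le_hausdorff d FQ).
    by apply: lt_le_trans hF; rewrite lte_fin.
  have ma : m <= a * t `^ d by rewrite -lee_fin -mE; apply: upp => //; lra.
  apply: le_trans (exp_mean_reverse (measurable_ball x t)
    mF FQ mE m0 m'0 hF _ fF p1) _.
    by move=> z [_ xz]; apply: fs; exact: ltW.
  apply: lee_wpmul2r => //; rewrite lee_fin le_max; apply/orP; left.
  rewrite /C1 (_ : s - (s - N) = N); last by ring.
  rewrite ler_pM2r ?expR_gt0// ler_pdivrMr//.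
  have -> : 2 * a / b * (b / 2 * t `^ d) = a * t `^ d by field; rewrite lt0r_neq0.
  by [].
(* For t > T the set [F] found at scale T still lies in the larger disc. On K, f is at most B, which
   exceeds s by at most L. *)
have [s [F [mF FT hF [fs fF] sL]]] := half x T Kx T0 (lexx T) TD.
have FQ : F `<=` Q.
  by move=> z /FT[Kz xz]; split => //; exact: lt_trans xz Tt.
have m0 : 0 < m.
  rewrite -lte_fin -mE; apply: lt_le_trans (le_hausdorff d FQ).
  by apply: lt_le_trans hF; rewrite lte_fin.
apply: le_trans (exp_mean_reverse (sigma := B) (measurable_ball x t)
  mF FQ mE m0 m10 hF _ fF p1) _.
  move=> z [Kz _]; apply: (rB z z Kz); rewrite /closed_disc /= normcBxx.
  by rewrite mulr_ge0// ltW.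
apply: lee_wpmul2r => //; rewrite lee_fin le_max; apply/orP; right.
apply: ler_pM; rewrite ?expR_ge0 ?divr_ge0 ?(ltW m0) ?(ltW m10)//.
  rewrite ler_pM2r ?invr_gt0//.
  by rewrite -lee_fin -mE.
by rewrite ler_expR /L; lra.
Qed.

End assembly.

(* hK1 excludes one-point sets: they satisfy d_set vacuously, since diam K = 0,
   but H^d(K) = 0 and the averages are not defined. *)
Theorem theorem1p4 (R : realType) (d : R) (hd : 0 < d)
    (K : set R[i]) (hKc : compact K) (hKd : d_set d K)
    (hK1 : forall z : R[i], K <> [set z])
    (U : set R[i]) (hU : open U) (hKU : K `<=` U)
    (f : R[i] -> \bar R) (hf : subharmonic U f) :
  exists C : R, forall (x : R[i]) (t : R) (p : \bar R),
    K x -> 0 < t -> (1 <= p)%E ->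
    (exp_mean d p (disc x t `&` K) f <=
     C%:E * haverage d (disc x t `&` K) (fun z => expeR (f z)))%E.
Proof.
have [a [b [a0 b0 hab]]] := hKd.
have [/set0P[y Ky]|/negPn/eqP K0] := boolP (K != set0); last first.
  by exists 0 => x t p; rewrite K0.
have [z Kz zy] : exists2 z, K z & z != y.
  apply: contrapT => nz; apply: (hK1 y); apply/seteqP; split=> [z Kz|_ ->//].
  by apply: contrapT => /eqP zy; apply: nz; exists z.
(* The distance of two distinct points of K is a positive real scale below the diameter, up to which
   the regularity bounds hold. *)
have D0 : 0 < normc (z - y) by rewrite normc_gt0// subr_eq0.
have Dle : ((normc (z - y))%:E <= diam K)%E.
  by apply: ereal_sup_ubound; exists (z, y).
apply: (exp_mean_comparison hU hf hKc a0 b0 hd D0) => // x s Kx s0 sD.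
  by have [] := hab x s Kx s0 (le_trans (_ : s%:E <= _)%E Dle).
by have [] := hab x s Kx s0 (le_trans (_ : s%:E <= _)%E Dle).
Qed.
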